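(* Suppose that the alternative $H_1$ holds: there exists $((\theta_1^*,\theta_2^* ),t^* )\in\Theta^2\times\{2,3,\dots,n-1\}$ with $\theta_1^*\neq\theta_2^*$ such that $(Y_1,\dots,Y_{t^*})$ is a trajectory of a process $Y^{(1)}=\{Y^{(1)}_t,\ t\in\mathbb{Z}\}$ that depends on $\theta_1^*$ and $(Y_{t^*+1},\dots,Y_n)$ is a trajectory of a process $Y^{(2)}=\{Y^{(2)}_t,\ t\in\mathbb{Z}\}$ that depends on $\theta_2^*$. Assume that $\theta_1^*$ and $\theta_2^*$ belong to the interior of $\Theta$, and that the conditions (A1)-(A4) given in the context hold for $(Y^{(1)},\theta_1^* )$ and for $(Y^{(2)},\theta_2^* )$. If, in addition, Assumption B is satisfied, that is, there exists $\tau^*\in(0,1)$ such that $t^*=[n\tau^*]$, where $[x]$ denotes the integer part of $x$, then the test statistic $\widehat Q_n$ defined in the context satisfies $$\widehat Q_n\ \xrightarrow[n\to\infty]{\ \mathcal P\ }\ +\infty .$$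
   Context: Setting. $\Theta\subset\mathbb{R}^d$ ($d\in\mathbb{N}$) is a fixed compact set. The observations $(Y_1,\dots,Y_n)$ are generated from a multivariate continuous or integer valued process. For $\ell\le\ell'$ in $\mathbb{N}$ put $T_{\ell,\ell'}=\{\ell,\ell+1,\dots,\ell'\}$. For any segment $T\subset\{1,\dots,n\}$ and $\theta\in\Theta$, the contrast function is $\widehat C(T,\theta)=\sum_{t\in T}\widehat\varphi_t(\theta)$, where $\widehat\varphi_t$ depends on $Y_1,\dots,Y_t$. The minimum contrast estimator (MCE) computed on $T$ is $\widehat\theta(T)=\operatorname{argmin}_{\theta\in\Theta}\widehat C(T,\theta)$. Norms. $\|x\|=\sum_i|x_i|$ for vectors, $\|x\|=\max_j\sum_i|x_{i,j}|$ for matrices, and $\|g\|_\Theta=\sup_{\theta\in\Theta}\|g(\theta)\|$ for vector or matrix valued functions $g$ on $\Theta$. Conditions (A1)-(A4) for a pair $(Y,\theta^* )$. These are formulated in the no-change situation: $Y=\{Y_t,\ t\in\mathbb{Z}\}$ is a multivariate continuous or integer valued process depending on a parameter $\theta^*\in\Theta$, and the observations $(Y_1,\dots,Y_n)$ are a trajectory of $Y$. Let $\mathcal F_{t-1}=\sigma\{Y_{t-1},\dots\}$ be the $\sigma$-field generated by the whole past at time $t-1$. Let $(j_n)_{n\ge1}$ and $(k_n)_{n\ge1}$ be two integer valued sequences such that $j_n\le k_n$, $k_n\to\infty$ and $k_n-j_n\to\infty$ as $n\to\infty$, and consider the segment $T_{j_n,k_n}$. That the conditions hold for $(Y^{(1)},\theta_1^*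 )$ (respectively $(Y^{(2)},\theta_2^* )$) means that they hold with $(Y,\theta^* )$ replaced by $(Y^{(1)},\theta_1^* )$ (respectively $(Y^{(2)},\theta_2^* )$). (A1) The process $Y$ is stationary and ergodic. (A2) $\widehat\theta(T_{j_n,k_n})$ converges almost surely to $\theta^*$. (A3) For all $t\in T_{j_n,k_n}$, the function $\theta\mapsto\widehat\varphi_t(\theta)$ is continuously differentiable on $\Theta$; in addition, there exists a sequence of random functions $(\varphi_t(\cdot))_{t\in\mathbb{Z}}$ such that $\theta\mapsto\varphi_t(\theta)$ is continuously differentiable on $\Theta$ and, for all $\theta\in\Theta$, the sequence $(\partial\varphi_t(\theta)/\partial\theta)_{t\in\mathbb{Z}}$ is stationary and ergodic, satisfying $$\frac1{\sqrt{k_n-j_n}}\sum_{t\in T_{j_n,k_n}}\Big\|\frac{\partial}{\partial\theta}\widehat\varphi_t(\theta)-\frac{\partial}{\partial\theta}\varphi_t(\theta)\Big\|_\Theta=o_P(1)\quad\text{and}\quad \mathbb{E}\Big\|\frac{\partial}{\partial\theta}\varphi_t(\theta)\Big\|_\Theta^2<\infty .$$ Furthermore, $\big(\frac{\partial}{\partial\theta}\varphi_t(\theta^* ),\mathcal F_t\big)_{t\in\mathbb{Z}}$ is a stationary ergodic, square integrable martingale difference sequence with covariance $G=\mathbb{E}\big[\frac{\partial\varphi_0(\theta^* )}{\partial\theta}\frac{\partial\varphi_0(\theta^* )}{\partial\theta^T}\big]$ assumed to be positive definite. (A4) For all $t\in T_{j_n,k_n}$, the function $\theta\mapsto\widehat\varphi_t(\theta)$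 is twice continuously differentiable on $\Theta$; moreover, with $\varphi_t$ as in (A3), the function $\theta\mapsto\partial\varphi_t(\theta)/\partial\theta$ is continuously differentiable on $\Theta$ and the sequence $(\partial^2\varphi_t(\theta)/\partial\theta\partial\theta^T)_{t\in\mathbb{Z}}$ is stationary and ergodic, satisfying $$\mathbb{E}\Big\|\frac{\partial^2\varphi_t(\theta)}{\partial\theta\partial\theta^T}\Big\|_\Theta<\infty,\qquad \Big\|\frac1{k_n-j_n}\sum_{t\in T_{j_n,k_n}}\frac{\partial^2\widehat\varphi_t(\theta)}{\partial\theta\partial\theta^T}-\mathbb{E}\Big(\frac{\partial^2\varphi_0(\theta)}{\partial\theta\partial\theta^T}\Big)\Big\|_\Theta=o(1),$$ and the matrix $F=\mathbb{E}\big[\frac{\partial^2\varphi_0(\theta^* )}{\partial\theta\partial\theta^T}\big]$ is invertible. In addition, $\widehat\theta(T_{j_n,k_n})$ is asymptotically normal: $\sqrt{k_n-j_n}\,(\widehat\theta(T_{j_n,k_n})-\theta^* )\xrightarrow{\mathcal D}\mathcal N(0,\Omega)$ as $n\to\infty$, with $\Omega=F^{-1}GF^{-1}$. Test statistic (computed from the observations $(Y_1,\dots,Y_n)$). For $\ell\le\ell'$ define $$\widehat G(T_{\ell,\ell'})=\frac1{\ell'-\ell+1}\sum_{t\in T_{\ell,\ell'}}\frac{\partial}{\partial\theta}\widehat\varphi_t(\widehat\theta(T_{\ell,\ell'}))\frac{\partial}{\partial\theta^T}\widehat\varphi_t(\widehat\theta(T_{\ell,\ell'})),\qquad \widehat F(T_{\ell,\ell'})=\frac1{\ell'-\ell+1}\sum_{t\in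 T_{\ell,\ell'}}\frac{\partial^2}{\partial\theta\partial\theta^T}\widehat\varphi_t(\widehat\theta(T_{\ell,\ell'})).$$ Let $(u_n,v_n)_{n\ge1}$ be a bivariate integer valued sequence such that $(u_n,v_n)=o(n)$ and $u_n,v_n\to+\infty$ as $n\to\infty$. Put $\mathcal T_n=[v_n,n-v_n]\cap\mathbb{N}$ and $$\widehat\Omega(u_n)=\tfrac12\Big[\widehat F(T_{1,u_n})\widehat G(T_{1,u_n})^{-1}\widehat F(T_{1,u_n})+\widehat F(T_{u_n+1,n})\widehat G(T_{u_n+1,n})^{-1}\widehat F(T_{u_n+1,n})\Big].$$ For $1<k<n$, $$\widehat Q_{n,k}=\frac{(k(n-k))^2}{n^3}\big(\widehat\theta(T_{1,k})-\widehat\theta(T_{k+1,n})\big)^T\,\widehat\Omega(u_n)\,\big(\widehat\theta(T_{1,k})-\widehat\theta(T_{k+1,n})\big),\qquad \widehat Q_n=\max_{k\in\mathcal T_n}\widehat Q_{n,k}.$$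
   Formalization: Conditions (A1)-(A4) for Y^(2) are assumed for contrasts and estimators of the sample actually observed, on segments inside {t*+1,...,n}, not for a no-change sample of Y^(2); otherwise a contrast using early data could hide the change. Smoothness on Θ means on a neighbourhood. *)

(* Defs.v *)
From HB Require Import structures.
From mathcomp Require Import all_boot all_order all_algebra.
From mathcomp Require Import all_classical all_reals all_analysis.

Set Implicit Arguments.
Unset Strict Implicit.
Unset Printing Implicit Defensive.

Import Order.TTheory GRing.Theory Num.Theory.
Import numFieldNormedType.Exports.

Local Open Scope classical_set_scope.
Local Open Scope ring_scope.

(* On a single column this is the l1 norm of the vector. *)
Definition mxnorm1 {R : realType} {p q : nat} (A : 'M[R]_(p, q)) : R :=
  \big[Num.max/0]_(j < q) \sum_(i < p) `|A i j|.

Definition supnorm {R : realType} {d p q : nat} (Theta : set 'cV[R]_d)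
    (g : 'cV[R]_d -> 'M[R]_(p, q)) : \bar R :=
  ereal_sup [set (mxnorm1 (g x))%:E | x in Theta].

Definition posdefmx {R : realType} {d : nat} (A : 'M[R]_d) : Prop :=
  forall x : 'cV[R]_d, x != 0 -> 0 < (x^T *m A *m x) 0 0.

Definition partial {R : realType} {d : nat} (i : 'I_d) (f : 'cV[R]_d -> R)
    (x : 'cV[R]_d) : R := 'D_(delta_mx i 0) f x.

Definition gradient {R : realType} {d : nat} (f : 'cV[R]_d -> R)
    (x : 'cV[R]_d) : 'cV[R]_d := \col_i partial i f x.

Definition hessian {R : realType} {d : nat} (f : 'cV[R]_d -> R)
    (x : 'cV[R]_d) : 'M[R]_d := \matrix_(i, j) partial i (partial j f) x.

(* Smoothness on a compact set, at the boundary as well, is understood as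
   smoothness on some open neighbourhood of that set. *)
Definition C1_on {R : realType} {d : nat} (Theta : set 'cV[R]_d)
    (f : 'cV[R]_d -> R) : Prop :=
  exists U : set 'cV[R]_d, [/\ open U, Theta `<=` U &
    forall x, U x ->
      differentiable f x /\ forall i, {for x, continuous (partial i f)}].

Definition C2_on {R : realType} {d : nat} (Theta : set 'cV[R]_d)
    (f : 'cV[R]_d -> R) : Prop :=
  C1_on Theta f /\ forall i, C1_on Theta (partial i f).

(* A process is given by its real coordinates, which are indexed by an
   arbitrary type I: 'I_m for R^m-valued processes, Theta * 'I_d * 'I_d for
   processes whose values are matrix-valued functions on Theta.  The path space
   int -> I -> R carries the product sigma-algebra. *)
Definition path_events (R : realType) (I : Type) : set (set (int -> I -> R)) :=
  <<s [set C | exists t i (B : set R),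
         measurable B /\ C = [set x : int -> I -> R | B (x t i)]] >>.

Definition stationary {R : realType} {dT : measure_display}
    {T : measurableType dT} (P : probability T R) {I : Type}
    (X : int -> T -> I -> R) : Prop :=
  (forall t i, measurable_fun setT (fun w => X t w i)) /\
  forall A, @path_events R I A ->
    P [set w | A (fun t => X (t + 1) w)] = P [set w | A (fun t => X t w)].

Definition ergodic {R : realType} {dT : measure_display}
    {T : measurableType dT} (P : probability T R) {I : Type}
    (X : int -> T -> I -> R) : Prop :=
  forall A, @path_events R I A ->
    (forall x : int -> I -> R, A (fun t => x (t + 1)) <-> A x) ->
    P [set w | A (fun t => X t w)] = 0%E \/
    P [set w | A (fun t => X t w)] = 1%E.

Definition coords {R : realType} {T : Type} {d : nat}
    (X : int -> T -> 'cV[R]_d) : int -> T -> 'I_d -> R :=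
  fun t w i => X t w i 0.

(* F_t = sigma{Y_t, Y_(t-1), ...} *)
Definition past {R : realType} {T : Type} {m : nat}
    (Y : int -> T -> m.-tuple R) (t : int) : set (set T) :=
  <<s [set A | exists s i (B : set R),
         [/\ s <= t, measurable B & A = [set w | B (tnth (Y s w) i)]]] >>.

(* The last clause is E[X_t | F_(t-1)] = 0. *)
Definition martingale_difference {R : realType} {dT : measure_display}
    {T : measurableType dT} (P : probability T R) {d : nat}
    (F : int -> set (set T)) (X : int -> T -> 'cV[R]_d) : Prop :=
  forall t i,
    [/\ forall B : set R, measurable B -> F t [set w | B (X t w i 0)],
        P.-integrable setT (fun w => (X t w i 0)%:E) &
        forall A, F (t - 1) A -> \int[P]_(w in A) X t w i 0 = 0].

Definition square_integrable {R : realType} {dT : measure_display}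
    {T : measurableType dT} (P : probability T R) {d : nat}
    (X : int -> T -> 'cV[R]_d) : Prop :=
  forall t i, P.-integrable setT (fun w => (X t w i 0 ^+ 2)%:E).

Definition expect_mx {R : realType} {dT : measure_display}
    {T : measurableType dT} (P : probability T R) {p q : nat}
    (X : T -> 'M[R]_(p, q)) : 'M[R]_(p, q) :=
  \matrix_(i, j) \int[P]_w X w i j.

(* Z ~ N(0, Omega): every u^T Z is N(0, u^T Omega u).  The null-variance case
   is the Dirac mass at 0; it is singled out because normal_prob 0 0 is not. *)
Definition centered_gaussian {R : realType} {dT : measure_display}
    {T : measurableType dT} (P : probability T R) {d : nat}
    (Z : T -> 'cV[R]_d) (Omega : 'M[R]_d) : Prop :=
  (forall i, measurable_fun setT (fun w => Z w i 0)) /\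
  forall (u : 'cV[R]_d) (B : set R), measurable B ->
    P [set w | B ((u^T *m Z w) 0 0)] =
    let s2 := (u^T *m Omega *m u) 0 0 in
    if s2 == 0 then \d_(0 : R) B else normal_prob 0 (Num.sqrt s2) B.

Definition cvg_dist_normal {R : realType} {dT : measure_display}
    {T : measurableType dT} (P : probability T R) {d : nat}
    (X : nat -> T -> 'cV[R]_d) (Omega : 'M[R]_d) : Prop :=
  exists (dT' : measure_display) (T' : measurableType dT')
         (P' : probability T' R) (Z : T' -> 'cV[R]_d),
    centered_gaussian P' Z Omega /\
    forall f : 'cV[R]_d -> R, continuous f ->
      (exists M : R, forall x, `|f x| <= M) ->
      \int[P]_w f (X n w) @[n --> \oo] --> \int[P']_w f (Z w).

(* S n = o_P(1), for nonnegative S *)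
Definition cvg0_in_probability {R : realType} {dT : measure_display}
    {T : measurableType dT} (P : probability T R) (S : nat -> T -> \bar R) :
    Prop :=
  forall e : R, 0 < e -> P [set w | (e%:E < S n w)%E] @[n --> \oo] --> 0%E.

Definition cvg_pinfty_in_probability {R : realType} {dT : measure_display}
    {T : measurableType dT} (P : probability T R) (S : nat -> T -> \bar R) :
    Prop :=
  forall M : R, P [set w | (M%:E < S n w)%E] @[n --> \oo] --> 1%E.

(* Below, a contrast is a function c : nat -> 'cV[R]_d -> R, where c t stands
   for the function hat(phi)_t. *)

Definition history {E : Type} (y : nat -> E) (t : nat) : t.-tuple E :=
  [tuple y i.+1 | i < t].

Definition sample_contrasts {R : realType} {T : Type} {d m : nat}
    (phihat : forall t : nat, t.-tuple (m.-tuple R) -> 'cV[R]_d -> R)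
    (Y : nat -> nat -> T -> m.-tuple R) (n : nat) (w : T) (t : nat) :
    'cV[R]_d -> R :=
  phihat t (history (fun s => Y n s w) t).

Definition contrast {R : realType} {d : nat} (c : nat -> 'cV[R]_d -> R)
    (l l' : nat) (x : 'cV[R]_d) : R :=
  \sum_(l <= t < l'.+1) c t x.

(* The argmin need not be unique: x is one of the minimisers. *)
Definition is_MCE {R : realType} {d : nat} (Theta : set 'cV[R]_d)
    (c : nat -> 'cV[R]_d -> R) (l l' : nat) (x : 'cV[R]_d) : Prop :=
  Theta x /\ forall y, Theta y -> contrast c l l' x <= contrast c l l' y.

Definition Ghat {R : realType} {d : nat} (c : nat -> 'cV[R]_d -> R)
    (th : nat -> nat -> 'cV[R]_d) (l l' : nat) : 'M[R]_d :=
  (l' - l + 1)%N%:R^-1 *: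
  \sum_(l <= t < l'.+1)
     gradient (c t) (th l l') *m (gradient (c t) (th l l'))^T.

Definition Fhat {R : realType} {d : nat} (c : nat -> 'cV[R]_d -> R)
    (th : nat -> nat -> 'cV[R]_d) (l l' : nat) : 'M[R]_d :=
  (l' - l + 1)%N%:R^-1 *: \sum_(l <= t < l'.+1) hessian (c t) (th l l').

Definition Omegahat {R : realType} {d : nat} (c : nat -> 'cV[R]_d -> R)
    (th : nat -> nat -> 'cV[R]_d) (n u : nat) : 'M[R]_d :=
  2%:R^-1 *:
  (Fhat c th 1 u *m invmx (Ghat c th 1 u) *m Fhat c th 1 u +
   Fhat c th u.+1 n *m invmx (Ghat c th u.+1 n) *m Fhat c th u.+1 n).

Definition Qhat_at {R : realType} {d : nat} (c : nat -> 'cV[R]_d -> R)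
    (th : nat -> nat -> 'cV[R]_d) (n u k : nat) : R :=
  let D := th 1 k - th k.+1 n in
  (k * (n - k))%N%:R ^+ 2 / n%:R ^+ 3 * (D^T *m Omegahat c th n u *m D) 0 0.

(* The maximum over v <= k <= n - v is -oo when there is no such k. *)
Definition Qhat {R : realType} {d : nat} (c : nat -> 'cV[R]_d -> R)
    (th : nat -> nat -> 'cV[R]_d) (n u v : nat) : \bar R :=
  \big[maxe/-oo%E]_(0 <= k < n.+1 | (v <= k)%N && (k + v <= n)%N)
     (Qhat_at c th n u k)%:E.

(* Conditions on a process Y and a parameter theta.  In what follows,
   c n w t is hat(phi)_t computed from the sample of size n, thetahat n l l' is
   the minimum contrast estimator on {l,...,l'} computed from that sample, and
   a n, ..., b n are the dates at which the sample of size n is a trajectory of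
   Y: a n = 1 and b n = n in the absence of change. *)

Definition segments (a b j k : nat -> nat) : Prop :=
  [/\ \forall n \near \oo, [&& a n <= j n, j n <= k n & k n <= b n]%N,
      k n @[n --> \oo] --> \oo &
      (k n - j n)%N @[n --> \oo] --> \oo].

Definition condA1 {R : realType} {dT : measure_display}
    {T : measurableType dT} (P : probability T R) {m : nat}
    (Y : int -> T -> m.-tuple R) : Prop :=
  stationary P (fun t w i => tnth (Y t w) i) /\
  ergodic P (fun t w i => tnth (Y t w) i).

Definition condA2 {R : realType} {dT : measure_display}
    {T : measurableType dT} (P : probability T R) {d : nat}
    (thetahat : nat -> nat -> nat -> T -> 'cV[R]_d) (j k : nat -> nat)
    (theta : 'cV[R]_d) : Prop :=
  {ae P, forall w, thetahat n (j n) (k n) w @[n --> \oo] --> theta}.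

Definition Gmx {R : realType} {dT : measure_display}
    {T : measurableType dT} (P : probability T R) {d : nat}
    (phi : int -> T -> 'cV[R]_d -> R) (theta : 'cV[R]_d) : 'M[R]_d :=
  expect_mx P (fun w =>
    gradient (phi 0 w) theta *m (gradient (phi 0 w) theta)^T).

Definition Fmx {R : realType} {dT : measure_display}
    {T : measurableType dT} (P : probability T R) {d : nat}
    (phi : int -> T -> 'cV[R]_d -> R) (theta : 'cV[R]_d) : 'M[R]_d :=
  expect_mx P (fun w => hessian (phi 0 w) theta).

Definition condA3 {R : realType} {dT : measure_display}
    {T : measurableType dT} (P : probability T R) {d m : nat}
    (Theta : set 'cV[R]_d) (c : nat -> T -> nat -> 'cV[R]_d -> R)
    (Y : int -> T -> m.-tuple R) (j k : nat -> nat) (theta : 'cV[R]_d)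
    (phi : int -> T -> 'cV[R]_d -> R) : Prop :=
  (\forall n \near \oo, forall t w,
     (j n <= t <= k n)%N -> C1_on Theta (c n w t)) /\
  (forall t x, Theta x -> measurable_fun setT (fun w => phi t w x)) /\
  (forall t w, C1_on Theta (phi t w)) /\
  (forall x, Theta x ->
     stationary P (coords (fun t w => gradient (phi t w) x)) /\
     ergodic P (coords (fun t w => gradient (phi t w) x))) /\
  cvg0_in_probability P (fun n w =>
    ((Num.sqrt (k n - j n)%N%:R)^-1%:E *
     \sum_(j n <= t < (k n).+1)
        supnorm Theta (fun x =>
          (gradient (c n w t) x - gradient (phi t%:Z w) x)%R))%E) /\
  (forall t,
     (\int[P]_w (supnorm Theta (gradient (phi t w)) ^+ 2) < +oo)%E) /\
  (let X := fun t w => gradient (phi t w) theta in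
   stationary P (coords X) /\ ergodic P (coords X) /\
   square_integrable P X /\ martingale_difference P (past Y) X) /\
  posdefmx (Gmx P phi theta).

(* Unlike the stationarity and ergodicity of the first derivatives, required for
   each fixed parameter, those of the second derivatives bear on the sequence
   of functions of the parameter. *)
Definition condA4 {R : realType} {dT : measure_display}
    {T : measurableType dT} (P : probability T R) {d : nat}
    (Theta : set 'cV[R]_d) (c : nat -> T -> nat -> 'cV[R]_d -> R)
    (thetahat : nat -> nat -> nat -> T -> 'cV[R]_d)
    (j k : nat -> nat) (theta : 'cV[R]_d)
    (phi : int -> T -> 'cV[R]_d -> R) : Prop :=
  (\forall n \near \oo, forall t w,
     (j n <= t <= k n)%N -> C2_on Theta (c n w t)) /\
  (forall t w i, C1_on Theta (partial i (phi t w))) /\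
  (let H := fun t w (x : Theta * 'I_d * 'I_d) =>
     hessian (phi t w) (set_val x.1.1) x.1.2 x.2 in
   stationary P H /\ ergodic P H) /\
  (forall t, (\int[P]_w supnorm Theta (hessian (phi t w)) < +oo)%E) /\
  {ae P, forall w,
     supnorm Theta (fun x =>
       (k n - j n)%N%:R^-1 *:
         (\sum_(j n <= t < (k n).+1) hessian (c n w t) x) - Fmx P phi x)
     @[n --> \oo] --> 0%E} /\
  Fmx P phi theta \in unitmx /\
  cvg_dist_normal P
    (fun n w => Num.sqrt (k n - j n)%N%:R *:
                (thetahat n (j n) (k n) w - theta))
    (invmx (Fmx P phi theta) *m Gmx P phi theta *m invmx (Fmx P phi theta)).

Definition conditionsA {R : realType} {dT : measure_display}
    {T : measurableType dT} (P : probability T R) {d m : nat}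
    (Theta : set 'cV[R]_d) (c : nat -> T -> nat -> 'cV[R]_d -> R)
    (thetahat : nat -> nat -> nat -> T -> 'cV[R]_d) (a b : nat -> nat)
    (Y : int -> T -> m.-tuple R) (theta : 'cV[R]_d) : Prop :=
  condA1 P Y /\
  forall j k, segments a b j k ->
    condA2 P thetahat j k theta /\
    exists phi, condA3 P Theta c Y j k theta phi /\
                condA4 P Theta c thetahat j k theta phi.

Definition change_at {T E : Type} (y : nat -> T -> E) (Y1 Y2 : int -> T -> E)
    (n tstar : nat) : Prop :=
  (2 <= tstar <= n.-1)%N /\
  forall t w, (1 <= t <= n)%N ->
    y t w = if (t <= tstar)%N then Y1 t%:Z w else Y2 t%:Z w.

(* Main.v *)
(* The maximum is at least its term at the change point, whose prefactor is of
   order n and where the two estimators converge to theta1 <> theta2.  The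
   second half of hat(Omega)(u_n), which mixes the two regimes, is only known to
   be positive semidefinite (Hessians are symmetric, hat(G) is a Gram matrix),
   and this is enough.  For the first half, y^T G^-1 y >= |y|^2 / b as soon as
   z^T G z <= b |z|^2 for all z; here y tends to F (theta1 - theta2), which is
   nonzero, and b can be taken of order u_n = o(n).

   It remains that hat(G)(T_{1,u_n}) is invertible with probability tending to
   1.  Its null space is that of u_n^-1 \sum_t s(a_t) s(a_t)^T, where a_t is the
   gradient of hat(phi)_t at the estimator and s(a) = a / (1 + |a|).  Since s is
   bounded and Lipschitz, the ergodic theorem for bounded functions yields a
   limit, whose determinant does not vanish because G is positive definite.
   Replacing a_t by the gradient of phi_t at theta1 costs the approximation error
   of (A3) and the suprema of the Hessians of (A4) times |hat(theta) - theta1|,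
   which are controlled on events of probability close to 1.

   A probability says nothing about nonmeasurable sets, so the statistic and
   the suprema over Theta have to be shown measurable: derivatives at a random
   point are limits of difference quotients along a grid, and suprema are taken
   over a countable dense subset. *)
Require Import Defs.
From HB Require Import structures.
From mathcomp Require Import all_boot all_order all_algebra.
From mathcomp Require Import all_classical all_reals all_analysis.
From mathcomp Require Import measurable_realfun ring lra.

Set Implicit Arguments.
Unset Strict Implicit.
Unset Printing Implicit Defensive.

Import Order.TTheory GRing.Theory Num.Theory.
Import numFieldNormedType.Exports.

Local Open Scope classical_set_scope.
Local Open Scope ring_scope.

(** * Partial derivatives and difference quotients *)

Lemma norm_coord_le {R : realType} m n (A : 'M[R]_(m, n)) i j :
  `|A i j| <= `|A|.
Proof. by rewrite [leRHS]/Num.norm /= mx_normrE; apply/bigmax_geP; right; exists (i, j). Qed.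

Lemma norm_mx_le {R : realType} m n (A : 'M[R]_(m, n)) (e : R) :
  0 <= e -> (forall i j, `|A i j| <= e) -> `|A| <= e.
Proof.
move=> e0 Ae; rewrite [leLHS]/Num.norm /= mx_normrE.
by apply/bigmax_leP; split => // -[i j] _; exact: Ae.
Qed.

Lemma cvg_mx_entries {R : realType} {U : Type} (F : set_system U) {FF : Filter F}
    m n (X : U -> 'M[R]_(m, n)) (L : 'M[R]_(m, n)) :
  (forall i j, X x i j @[x --> F] --> L i j) -> X @ F --> L.
Proof.
move=> XL; apply/cvgrPdist_le => e e0.
have : \forall x \near F, forall i j, `|L i j - X x i j| <= e.
  apply: filter_forall => i; apply: filter_forall => j.
  by move/cvgrPdist_le : (XL i j); exact.
apply: filterS => x Hx; apply: norm_mx_le (ltW e0) _ => i j.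
by rewrite !mxE.
Qed.

Lemma cvg_entry {R : realType} {U : Type} (F : set_system U) {FF : Filter F}
    m n (X : U -> 'M[R]_(m, n)) (L : 'M[R]_(m, n)) i j :
  X @ F --> L -> X x i j @[x --> F] --> L i j.
Proof. by move=> XL; exact: (cvg_comp X _ XL (@coord_continuous R _ _ i j L)). Qed.

Lemma mean_value_direction {R : realType} d (g : 'cV[R]_d -> R) (x v : 'cV[R]_d) :
  (forall s : R, 0 <= s <= 1 -> differentiable g (x + s *: v)) ->
  exists2 s : R, 0 <= s <= 1 & g (x + v) - g x = 'D_v g (x + s *: v).
Proof.
move=> dg; pose h (s : R) := g (x + s *: v).
have quotE (s : R) : (fun e : R => e^-1 *: ((h \o shift s) (e *: (1 : R)) - h s)) =
    (fun e : R => e^-1 *: ((g \o shift (x + s *: v)) (e *: v) - g (x + s *: v))).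
  apply/funext => e /=; rewrite /h /shift /= [e *: 1]mulr1.
  by rewrite scalerDl addrCA.
have dh (s : R) : 0 <= s <= 1 -> is_derive s (1 : R) h ('D_v g (x + s *: v)).
  move=> s01; have := @diff_derivable _ _ _ _ _ v (dg _ s01) => dgs.
  by split; [rewrite /derivable quotE | rewrite /derive quotE].
have [||s sI E] := @MVT_segment R h (fun s => 'D_v g (x + s *: v)) 0 1 ler01.
- by move=> s; rewrite in_itv /= => /andP[s0 s1]; apply: dh; rewrite !ltW.
  suff hc : {in `[(0 : R), 1]%classic, continuous h} by exact: continuous_in_subspaceT hc.
  move=> s; rewrite inE /= in_itv /= => /dh hs.
  by apply/differentiable_continuous/derivable1_diffP.
exists s; first by move: sI; rewrite in_itv.
by move: E; rewrite /h scale1r scale0r addr0 subr0 mulr1.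
Qed.

Lemma derive_partial {R : realType} d (g : 'cV[R]_d -> R) (x v : 'cV[R]_d) :
  differentiable g x -> 'D_v g x = \sum_i v i 0 * partial i g x.
Proof.
move=> dg; rewrite deriveE// {1}(matrix_sum_delta v) linear_sum.
apply: eq_bigr => i _; rewrite big_ord1 linearZ /=.
by rewrite /partial deriveE.
Qed.

Lemma mean_value_partial {R : realType} d (g : 'cV[R]_d -> R) (x : 'cV[R]_d)
    (i : 'I_d) (h : R) :
  (forall s : R, `|s| <= `|h| -> differentiable g (x + s *: delta_mx i 0)) ->
  exists2 s : R, `|s| <= `|h| &
    g (x + h *: delta_mx i 0) - g x = h * partial i g (x + s *: delta_mx i 0).
Proof.
move=> dg.
have sh (s : R) : 0 <= s <= 1 -> `|s * h| <= `|h|.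
  by move=> /andP[s0 s1]; rewrite normrM ger0_norm// ler_piMl.
have [s s01|s s01 E] := @mean_value_direction R d g x (h *: delta_mx i 0).
  by rewrite scalerA; apply/dg/sh.
exists (s * h); first exact: sh.
rewrite E scalerA deriveE; last exact/dg/sh.
by rewrite linearZ /= /partial deriveE //; apply/dg/sh.
Qed.

Lemma norm_scale_delta {R : realType} d (i : 'I_d) (s : R) :
  `|s *: (delta_mx i 0 : 'cV[R]_d)| <= `|s|.
Proof.
rewrite normrZ ler_piMr//; apply: norm_mx_le => // k l.
by rewrite mxE; case: (_ && _); rewrite ?normr1 ?normr0.
Qed.

Lemma partial_quotient_cvg {R : realType} d (f : 'cV[R]_d -> R) (x : 'cV[R]_d)
    (y : nat -> 'cV[R]_d) (h : nat -> R) (i : 'I_d) :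
  C1_on [set x] f -> y @ \oo --> x -> h @ \oo --> (0 : R) ->
  (forall k, h k != 0) ->
  (f (y k + h k *: delta_mx i 0) - f (y k)) / h k @[k --> \oo] --> partial i f x.
Proof.
move=> [U [oU xU HU]] yx h0 hn0.
have Ux : U x by exact: xU.
have [_ /(_ i) cf] := HU _ Ux.
apply/cvgrPdist_lt => e e0.
have : \forall z \near x, U z /\ `|partial i f x - partial i f z| < e.
  near=> z; split; first by near: z; exact: open_nbhs_nbhs.
  by near: z; move/cvgrPdist_lt : cf; exact.
move=> /nbhs_normP[r /= r0 Hr].
have Hb (z : 'cV[R]_d) : `|x - z| < r -> U z /\ `|partial i f x - partial i f z| < e.
  by move=> ?; apply: Hr.
have r2 : 0 < r / 2 by rewrite divr_gt0.
near=> k.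
have yk : `|x - y k| < r / 2 by near: k; move/cvgrPdist_lt : yx; exact.
have hk : `|h k| < r / 2.
  by rewrite -normrN -[- _]add0r; near: k; move/cvgrPdist_lt : h0; exact.
have xz (s : R) : `|s| <= `|h k| -> `|x - (y k + s *: delta_mx i 0)| < r.
  move=> sh; rewrite opprD addrA (le_lt_trans (ler_normB _ _))// (splitr r).
  by rewrite ltrD// (le_lt_trans (norm_scale_delta _ _))// (le_lt_trans sh).
have [s /xz/Hb[Uz _]|s /xz/Hb[_ ?] ->] := @mean_value_partial R d f (y k) i (h k).
  by have [] := HU _ Uz.
by rewrite mulrAC mulfV// mul1r.
Unshelve. all: by end_near. Qed.

Lemma derive_shift {R : realType} {V W : normedModType R} (f : V -> W) (a x v : V) :
  'D_v (fun z => f (z + a)) x = 'D_v f (x + a).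
Proof.
rewrite /derive; set u := (X in lim (X @ _) = _); set v' := (X in _ = lim (X @ _)).
by suff -> : u = v' by []; apply/funext => h; rewrite /u /v' /= addrA.
Qed.

Lemma differentiable_shift {R : realType} {V W : normedModType R} (f : V -> W) (a x : V) :
  differentiable f (x + a) -> differentiable (fun z => f (z + a)) x.
Proof.
by move=> df; apply: (@differentiable_comp _ _ _ _ (fun z : V => z + a) f).
Qed.

Lemma hessian_quotient_cvg {R : realType} d (f : 'cV[R]_d -> R) (x : 'cV[R]_d)
    (y : nat -> 'cV[R]_d) (h : nat -> R) (i j : 'I_d) :
  C2_on [set x] f -> y @ \oo --> x -> h @ \oo --> (0 : R) ->
  (forall k, h k != 0) ->
  (f (y k + h k *: delta_mx i 0 + h k *: delta_mx j 0) - f (y k + h k *: delta_mx i 0)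
   - (f (y k + h k *: delta_mx j 0) - f (y k))) / h k ^+ 2 @[k --> \oo]
  --> hessian f x i j.
Proof.
move=> [[U [oU xU HU]] /(_ j)[W [oW xW HW]]] yx h0 hn0.
have Ux : U x by exact: xU.
have Wx : W x by exact: xW.
have [_ /(_ i) cf] := HW _ Wx.
rewrite mxE; apply/cvgrPdist_lt => e e0.
have : \forall z \near x, [/\ U z, W z &
    `|partial i (partial j f) x - partial i (partial j f) z| < e].
  near=> z; split.
  - by near: z; exact: open_nbhs_nbhs.
  - by near: z; exact: open_nbhs_nbhs.
  - by near: z; move/cvgrPdist_lt : cf; exact.
move=> /nbhs_normP[r /= r0 Hr].
have Hb (z : 'cV[R]_d) : `|x - z| < r -> [/\ U z, W z &
    `|partial i (partial j f) x - partial i (partial j f) z| < e].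
  by move=> ?; apply: Hr.
have r3 : 0 < r / 3 by rewrite divr_gt0.
near=> k.
have yk : `|x - y k| < r / 3 by near: k; move/cvgrPdist_lt : yx; exact.
have hk : `|h k| < r / 3.
  by rewrite -normrN -[- _]add0r; near: k; move/cvgrPdist_lt : h0; exact.
have xz (s t : R) (a b : 'I_d) : `|s| <= `|h k| -> `|t| <= `|h k| ->
    `|x - (y k + s *: delta_mx a 0 + t *: delta_mx b 0)| < r.
  move=> sh th; rewrite 2!opprD !addrA.
  have -> : r = r / 3 + r / 3 + r / 3 by lra.
  rewrite (le_lt_trans (ler_normB _ _))// ltrD//; last first.
    by rewrite (le_lt_trans (norm_scale_delta _ _))// (le_lt_trans th).
  rewrite (le_lt_trans (ler_normB _ _))// ltrD//.
  by rewrite (le_lt_trans (norm_scale_delta _ _))// (le_lt_trans sh).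
have xz1 (s : R) (a : 'I_d) : `|s| <= `|h k| ->
    `|x - (y k + s *: delta_mx a 0)| < r.
  move=> sh; have := @xz s 0 a a sh; rewrite scale0r addr0; apply.
  by rewrite normr0.
pose g z := f (z + h k *: delta_mx i 0) - f z.
have dg (s : R) : `|s| <= `|h k| -> differentiable g (y k + s *: delta_mx j 0) /\
   partial j g (y k + s *: delta_mx j 0) =
     partial j f (y k + s *: delta_mx j 0 + h k *: delta_mx i 0) -
     partial j f (y k + s *: delta_mx j 0).
  move=> sh.
  have [U1 _ _] := Hb _ (xz s (h k) j i sh (lexx _)).
  have [U2 _ _] := Hb _ (xz1 s j sh).
  have [d1 _] := HU _ U1; have [d2 _] := HU _ U2.
  have dsh := differentiable_shift d1.
  split; first exact: differentiableB.
  rewrite {1}/partial deriveB; [|exact: diff_derivable..].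
  by rewrite derive_shift.
have [s /dg[]//|s sh] := @mean_value_partial R d g (y k) j (h k).
rewrite (dg s sh).2.
have [t th|t th] := @mean_value_partial R d (partial j f) (y k + s *: delta_mx j 0) i (h k).
  by have [_ + _] := Hb _ (xz s t j i sh th) => /HW[].
move=> -> E.
have -> : f (y k + h k *: delta_mx i 0 + h k *: delta_mx j 0) -
     f (y k + h k *: delta_mx i 0) -
     (f (y k + h k *: delta_mx j 0) - f (y k)) =
   g (y k + h k *: delta_mx j 0) - g (y k).
  by rewrite /g (addrAC (y k) (h k *: delta_mx i 0)); ring.
rewrite E mulrA -expr2 mulrAC mulfV ?mul1r ?expf_neq0//.
by have [] := Hb _ (xz s t j i sh th).
Unshelve. all: by end_near. Qed.

Lemma harmonic_neq0 {R : realType} k : harmonic k != 0 :> R.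
Proof. by rewrite /harmonic invr_neq0. Qed.

Lemma C1_on_sub {R : realType} d (A B : set 'cV[R]_d) f :
  A `<=` B -> C1_on B f -> C1_on A f.
Proof. by move=> AB [U [oU BU HU]]; exists U; split => // x /AB/BU. Qed.

Lemma C2_on_sub {R : realType} d (A B : set 'cV[R]_d) f :
  A `<=` B -> C2_on B f -> C2_on A f.
Proof.
by move=> AB [H1 H2]; split; [exact: C1_on_sub H1|move=> i; exact: C1_on_sub (H2 i)].
Qed.

(* The mixed second difference quotient is symmetric in the two directions. *)
Lemma hessian_sym {R : realType} d (f : 'cV[R]_d -> R) (x : 'cV[R]_d) :
  C2_on [set x] f -> (hessian f x)^T = hessian f x.
Proof.
move=> fC2; apply/matrixP => j i; rewrite mxE.
have Hc a b := @hessian_quotient_cvg R d f x _ _ a b fC2 (cvg_cst x) cvg_harmonic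
  harmonic_neq0.
rewrite -(cvg_lim (@norm_hausdorff _ _) (Hc _ i j)).
rewrite -(cvg_lim (@norm_hausdorff _ _) (Hc _ j i)).
set u := (X in lim (X @ _) = _); set v := (X in _ = lim (X @ _)).
suff -> : u = v by []; apply/funext => k; rewrite /u /v.
by rewrite (addrAC x (harmonic k *: delta_mx i 0)); congr (_ / _); ring.
Qed.

(** * The ergodic theorem for bounded functions *)

Lemma exists_natr_gt {R : archiRealFieldType} (r : R) : exists n : nat, r < n%:R.
Proof.
exists (Num.bound `|r|); apply: le_lt_trans (ler_norm r) _.
exact: archi_boundP.
Qed.

Section ergodic_averages.
Context {R : realType} {d : measure_display} {W : measurableType d}.
Variables (nu : probability W R) (tau : W -> W).
Hypothesis mtau : measurable_fun setT tau.
Hypothesis nu_tau : forall A, measurable A -> nu (tau @^-1` A) = nu A.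

Definition birkhoff_sum (g : W -> R) (n : nat) (x : W) : R :=
  \sum_(t < n) g (iter t tau x).

Lemma birkhoff_sumS (g : W -> R) n x :
  birkhoff_sum g n.+1 x = g x + birkhoff_sum g n (tau x).
Proof.
rewrite /birkhoff_sum big_ord_recl /=; congr (_ + _).
by apply: eq_bigr => i _; rewrite -iterSr.
Qed.

Lemma birkhoff_sumD (g : W -> R) m n x :
  birkhoff_sum g (m + n) x = birkhoff_sum g m x + birkhoff_sum g n (iter m tau x).
Proof.
elim: m x => [|m IH] x; first by rewrite {2}/birkhoff_sum big_ord0 add0r.
by rewrite addSn !birkhoff_sumS IH addrA -iterSr.
Qed.

Lemma measurable_iterate t : measurable_fun setT (fun x => iter t tau x).
Proof. by elim: t => [|t IH] /=; [exact: measurable_id|exact: measurableT_comp]. Qed.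

Lemma measurable_birkhoff_sum (g : W -> R) n :
  measurable_fun setT g -> measurable_fun setT (birkhoff_sum g n).
Proof.
move=> mg; apply: measurable_sum => t.
exact: (measurableT_comp mg (measurable_iterate t)).
Qed.

Lemma integral_iterate (f : W -> \bar R) t : measurable_fun setT f ->
  (forall x, 0 <= f x)%E -> (\int[nu]_x f (iter t tau x) = \int[nu]_x f x)%E.
Proof.
move=> mf f0; elim: t => // t <-.
have mft : measurable_fun setT (fun x => f (iter t tau x)).
  exact: (measurableT_comp mf (measurable_iterate t)).
rewrite -[RHS](@eq_measure_integral _ _ _ _ _ (pushforward nu tau)); last first.
  by move=> A mA _; exact: nu_tau.
rewrite ge0_integral_pushforward// preimage_setT.
by apply: eq_integral => x _; rewrite iterSr.
Qed.

Lemma integral_birkhoff_sum (g : W -> R) n : measurable_fun setT g -> (forall x, 0 <= g x) ->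
  (\int[nu]_x (birkhoff_sum g n x)%:E = n%:R%:E * \int[nu]_x (g x)%:E)%E.
Proof.
move=> mg g0; under eq_integral do rewrite /birkhoff_sum -sumEFin.
rewrite ge0_integral_sum//=.
- rewrite (eq_bigr (fun=> \int[nu]_x (g x)%:E))%E; last first.
    move=> t _; apply: (@integral_iterate (EFin \o g)); first exact/measurable_EFinP.
    by move=> x; rewrite lee_fin.
  elim: n => [|n IH]; first by rewrite big_ord0 mul0e.
  by rewrite big_ord_recr /= IH -natr1 EFinD ge0_muleDl// mul1e.
- move=> t; apply/measurable_EFinP.
  exact: (measurableT_comp mg (measurable_iterate t)).
- by move=> t x _; rewrite lee_fin.
Qed.

(* [good q M] is the set of points from which an average of length at most M
   is at least q.  A long orbit is cut greedily into such blocks and into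
   single bad points, each of which is given weight q. *)
Let good (g : W -> R) (q : R) (M : nat) : set W :=
  \bigcup_(n in [set n | (0 < n <= M)%N]) [set x | q * n%:R <= birkhoff_sum g n x].

Let greedy (g : W -> R) q M L x : (forall x, 0 <= g x) -> 0 <= q ->
  q * (L%:R - M%:R) <= birkhoff_sum (fun z => g z + q * \1_(~` good g q M) z) L x.
Proof.
move=> g0 q0; set h := fun z => _.
have h0 z : 0 <= h z by rewrite addr_ge0// mulr_ge0// indicE.
have bs0 n z : 0 <= birkhoff_sum h n z by rewrite sumr_ge0.
elim/ltn_ind: L x => L IH x.
have [LM|ML] := leqP L M.
  rewrite (le_trans _ (bs0 _ _))// mulr_ge0_le0// subr_le0 ler_nat//.
have [[n /= /andP[n0 nM] Hn]|xG] := pselect (good g q M x).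
  have nL : (n <= L)%N by rewrite (leq_trans nM)// ltnW.
  rewrite -(subnKC nL) birkhoff_sumD natrD -addrA mulrDr lerD//.
    apply: le_trans Hn _; apply: ler_sum => t _.
    by rewrite /h lerDl mulr_ge0// indicE.
  by apply: IH; rewrite ltn_subrL n0 (leq_trans n0 nL).
case: L ML IH => // L ML IH; rewrite birkhoff_sumS -natr1 -addrA addrCA mulrDr mulr1.
rewrite lerD//; last exact: IH.
by rewrite /h indicE mem_set// mulr1 lerDr.
Qed.

Lemma average_lower_bound (g : W -> R) q : measurable_fun setT g -> (forall x, 0 <= g x) ->
  0 <= q ->
  {ae nu, forall x, exists2 n, (0 < n)%N & q * n%:R <= birkhoff_sum g n x} ->
  (q%:E <= \int[nu]_x (g x)%:E)%E.
Proof.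
move=> mg g0 q0 aeg.
have mgood1 n : measurable [set x | q * n%:R <= birkhoff_sum g n x].
  rewrite -[X in measurable X]setTI.
  by apply: measurable_fun_le => //; exact: measurable_birkhoff_sum.
have mgood M : measurable (good g q M) by exact: bigcup_measurable.
have goodT : nu (\bigcup_M good g q M) = 1%E.
  have mU : measurable (\bigcup_M good g q M) by exact: bigcupT_measurable.
  apply: (@eq_trans _ _ (nu setT)); last exact: probability_setT.
  have [N [mN N0 HN]] := aeg.
  apply/eqP; rewrite eq_le; apply/andP; split.
    by apply: le_measure; rewrite ?inE.
  apply: (@le_trans _ _ (nu (\bigcup_M good g q M `|` N))); last first.
    apply: (le_trans (measureU2 _ _ _)) => //; rewrite -[leRHS]adde0.
    by apply: leeD2l; rewrite -N0.
  apply: le_measure; rewrite ?inE//; first exact: measurableU.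
  move=> x _; have [[n n0 Hn]|] := pselect (exists2 n, (0 < n)%N & q * n%:R <= birkhoff_sum g n x).
    by left; exists n => //; exists n => //=; rewrite n0 leqnn.
  by move=> nx; right; exact: HN.
have cvg_good : nu (good g q M) @[M --> \oo] --> 1%E.
  rewrite -goodT; apply: nondecreasing_cvg_mu => //; first exact: bigcupT_measurable.
  move=> m n mn; apply/subsetPset => x [k /= /andP[k0 km] Hk].
  by exists k => //=; rewrite k0 (leq_trans km).
set I := (\int[nu]_x (g x)%:E)%E.
have I0 : (0 <= I)%E by apply: integral_ge0 => x _; rewrite lee_fin.
case EI : I I0 => [c||] // c0; last by rewrite leey.
rewrite lee_fin in c0; rewrite lee_fin.
apply/ler_addgt0Pr => e e0.
have [M HM] : exists M, (nu (~` good g q M) <= (e / (q + 1))%:E)%E.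
  have qe : 0 < e / (q + 1) by rewrite divr_gt0// ltr_wpDl.
  have : \forall M \near \oo, ((1 - e / (q + 1))%:E < nu (good g q M))%E.
    have q1 : ((1 - e / (q + 1))%:E < 1%:E :> \bar R)%E by rewrite lte_fin gtrBl.
    exact: cvg_good (open_ereal_gt' q1).
  move=> [M _ /(_ M (leqnn M)) /= HM]; exists M.
  rewrite probability_setC// leeBlDr ?fin_num_measure//.
  by rewrite -leeBlDl// ltW// -EFinB.
set h := fun z => g z + q * \1_(~` good g q M) z.
have mh : measurable_fun setT h.
  apply: measurable_funD => //; apply: measurable_funM => //.
  by apply: measurable_indic; exact: measurableC.
have h0 z : 0 <= h z by rewrite addr_ge0// mulr_ge0// indicE.
have Ih : (\int[nu]_x (h x)%:E <= (c + e)%:E)%E.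
  under eq_integral do rewrite /h EFinD EFinM.
  have mi : measurable_fun setT (\1_(~` good g q M) : W -> R).
    by apply: measurable_indic; exact: measurableC.
  rewrite ge0_integralD//=; last 4 first.
  - by move=> x _; rewrite lee_fin.
  - exact/measurable_EFinP.
  - by move=> x _; rewrite -EFinM lee_fin mulr_ge0// indicE.
  - by apply: measurable_funeM; exact/measurable_EFinP.
  rewrite ge0_integralZl_EFin//=; last exact/measurable_EFinP.
  rewrite integral_indic ?setIT//; last exact: measurableC.
  rewrite -/I EI EFinD leeD2l//.
  apply: (@le_trans _ _ (q%:E * (e / (q + 1))%:E))%E.
    by rewrite lee_wpmul2l// lee_fin.
  rewrite -EFinM lee_fin mulrCA ler_piMr// ?(ltW e0)// ler_pdivrMr ?mul1r ?lerDl//.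
  by rewrite ltr_wpDl.
have HL L : (M <= L)%N -> q * (L%:R - M%:R) <= L%:R * (c + e).
  move=> ML.
  have qLM : 0 <= q * (L%:R - M%:R) by rewrite mulr_ge0// subr_ge0 ler_nat.
  rewrite -lee_fin EFinM.
  apply: (@le_trans _ _ (\int[nu]_x (birkhoff_sum h L x)%:E))%E; last first.
    by rewrite integral_birkhoff_sum// EFinM lee_wpmul2l.
  rewrite -[leLHS]mule1 -[X in (_ * X)%E](@probability_setT _ _ _ nu).
  rewrite -integral_cst//; apply: ge0_le_integral => //.
  - apply/measurable_EFinP; exact: measurable_birkhoff_sum.
  - by move=> x _ /=; rewrite -EFinM lee_fin; exact: greedy.
rewrite leNgt; apply/negP => ceq.
have [L] := exists_natr_gt (q * M%:R / (q - (c + e))).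
rewrite ltr_pdivrMr ?subr_gt0// => HLL.
have := HL (maxn M L) (leq_maxl _ _).
have : (L%:R <= (maxn M L)%:R :> R) by rewrite ler_nat leq_maxr.
move: (maxn M L)%:R => K LK H.
have : L%:R * (q - (c + e)) <= K * (q - (c + e)) by rewrite ler_pM2r ?subr_gt0.
lra.
Qed.

Hypothesis erg : forall A, measurable A -> (forall x, A (tau x) <-> A x) ->
  nu A = 0%E \/ nu A = 1%E.

Lemma birkhoff_upper (g : W -> R) (c e : R) : measurable_fun setT g -> (forall x, 0 <= g x) ->
  (\int[nu]_x (g x)%:E = c%:E)%E -> 0 < e ->
  {ae nu, forall x, \forall n \near \oo, birkhoff_sum g n x <= (c + e) * n%:R}.
Proof.
move=> mg g0 Ic e0.
have c0 : 0 <= c.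
  by rewrite -lee_fin -Ic; apply: integral_ge0 => x _; rewrite lee_fin.
(* [A] says that the limsup of the averages is at least c + e; unlike a bound
   at a fixed time, this is exactly invariant under [tau]. *)
pose A : set W := \bigcap_k \bigcap_N \bigcup_(n in [set n | (N <= n)%N])
  [set x | (c + e - k.+1%:R^-1) * n%:R <= birkhoff_sum g n x].
have mA : measurable A.
  apply: bigcapT_measurable => k; apply: bigcapT_measurable => N.
  apply: bigcup_measurable => n _; rewrite -[X in measurable X]setTI.
  by apply: measurable_fun_le => //; exact: measurable_birkhoff_sum.
have half k : (k.*2.+1.+1%:R^-1 : R) = k.+1%:R^-1 / 2.
  by rewrite -doubleS -muln2 natrM invfM.
have large (r s : R) N : 0 < r -> exists N', (N <= N')%N /\
    forall n, (N' <= n)%N -> s <= r * n%:R.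
  move=> r0; have [b sb] := exists_natr_gt (s / r).
  exists (maxn N b); split; first exact: leq_maxl.
  move=> n; rewrite geq_max => /andP[_ nb].
  by rewrite mulrC -ler_pdivrMr// (le_trans (ltW sb))// ler_nat.
have k2 k : 0 < k.+1%:R^-1 / 2 :> R by rewrite divr_gt0.
have e2 : 0 < e / 2 by rewrite divr_gt0.
have invA x : A (tau x) <-> A x.
  split => Ax k _ N _.
  - have [N' [NN' HN']] := large (k.+1%:R^-1 / 2) (c + e) N.+1 (k2 k).
    have [n /= N'n] := Ax k.*2.+1 I N' I.
    rewrite half => Hn; exists n.+1 => /=.
      by rewrite (leq_trans (ltnW NN'))// (leq_trans N'n).
    rewrite birkhoff_sumS; have := HN' _ N'n; have := g0 x.
    have : 0 < k.+1%:R^-1 :> R by [].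
    rewrite -[n.+1%:R]natr1; move: Hn.
    by move: (k.+1%:R^-1) (n%:R : R) (birkhoff_sum _ _ _) (g x) => a b S y; lra.
  - have [N' [NN' HN']] := large (k.+1%:R^-1 / 2) (g x + k.+1%:R^-1) N.+1 (k2 k).
    have [[//|n] /= N'n] := Ax k.*2.+1 I N'.+1 I.
    rewrite half => Hn; exists n => /=.
      by rewrite (leq_trans (ltnW NN')).
    move: Hn; rewrite birkhoff_sumS; have := HN' _ N'n; have := g0 x.
    have : 0 < k.+1%:R^-1 :> R by [].
    rewrite -[n.+1%:R]natr1.
    by move: (k.+1%:R^-1) (n%:R : R) (birkhoff_sum _ _ _) (g x) => a b S y; lra.
have nuA : nu A = 0%E.
  have [//|A1] := erg mA invA; exfalso.
  have : ((c + e / 2)%:E <= c%:E)%E.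
    rewrite -Ic; apply: average_lower_bound => //.
      by rewrite addr_ge0// divr_ge0// ltW.
    exists (~` A); split; first exact: measurableC.
      by rewrite probability_setC// A1 subee.
    move=> x nx Ax; apply: nx.
    have [N' [_ HN']] := large (e / 2) 1 0%N e2.
    have [n /= n0] := Ax N' I 1%N I.
    move=> Hn; exists n => //; apply: le_trans Hn.
    rewrite ler_wpM2r// -addrA lerD2l lerBrDr -lerBrDl.
    rewrite -[leLHS]mul1r ler_pdivrMr//.
    by apply: le_trans (HN' N'.+1 _) _ => //; lra.
  by rewrite lee_fin gerDl leNgt divr_gt0.
exists A; split => // x nx; apply: contrapT => nA; apply: nx.
move: nA => /existsNP[k] /not_implyP[_] /existsNP[N] /not_implyP[_] nA.
exists N => // n /= Nn; rewrite leNgt; apply/negP => Hn; apply: nA.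
exists n => //=; apply: le_trans (ltW Hn).
by rewrite ler_wpM2r// gerBl invr_ge0.
Qed.

Lemma birkhoff_bounded (g : W -> R) (K : R) : measurable_fun setT g ->
  (forall x, `|g x| <= K) ->
  {ae nu, forall x, birkhoff_sum g n x / n%:R @[n --> \oo] --> \int[nu]_z g z}.
Proof.
move=> mg gK.
have ig : nu.-integrable setT (EFin \o g).
  apply: (@le_integrable _ _ _ _ _ _ _ (cst K%:E)) => //.
  - exact/measurable_EFinP.
  - move=> x _ /=; rewrite lee_fin (le_trans (gK x)) ?ler_norm//.
  - exact: finite_measure_integrable_cst.
set c := \int[nu]_z g z.
have Ic : (\int[nu]_x (g x)%:E = c%:E)%E by rewrite /c /Rintegral fineK ?integrable_fin_num.
have iK : (\int[nu]_x (cst K%:E x) = K%:E)%E.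
  by rewrite integral_cst// -[RHS]mule1; congr (_ * _)%E; exact: probability_setT.
have up : {ae nu, forall x, forall m, \forall n \near \oo,
    birkhoff_sum (fun z => K + g z) n x <= (K + c + m.+1%:R^-1) * n%:R}.
  apply: ae_foralln => m; apply: birkhoff_upper => //.
  - exact: measurable_funD.
  - by move=> x; rewrite -lerBlDl sub0r lerNl (le_trans _ (gK x))// -normrN ler_norm.
  - under eq_integral do rewrite EFinD.
    rewrite (@integralD _ _ _ nu setT measurableT (cst K%:E) (EFin \o g))//.
      by rewrite iK Ic.
    exact: finite_measure_integrable_cst.
have lo : {ae nu, forall x, forall m, \forall n \near \oo,
    birkhoff_sum (fun z => K - g z) n x <= (K - c + m.+1%:R^-1) * n%:R}.
  apply: ae_foralln => m; apply: birkhoff_upper => //.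
  - exact: measurable_funB.
  - by move=> x; rewrite subr_ge0 (le_trans _ (gK x))// ler_norm.
  - under eq_integral do rewrite EFinB.
    rewrite (@integralB _ _ _ nu setT measurableT (cst K%:E) (EFin \o g))//.
      by rewrite iK Ic.
    exact: finite_measure_integrable_cst.
apply: filterS2 up lo => x upx lox.
apply/cvgrPdist_le => e e0.
have [m me] : exists m, m.+1%:R^-1 <= e.
  have [m em] := exists_natr_gt e^-1.
  exists m; rewrite -[leRHS]invrK lef_pV2 ?posrE ?invr_gt0//.
  by rewrite (le_trans (ltW em))// ler_nat.
near=> n.
have n0 : 0 < n%:R :> R by rewrite ltr0n; near: n; exact: nbhs_infty_gt.
have : birkhoff_sum (fun z => K + g z) n x <= (K + c + m.+1%:R^-1) * n%:R.
  by near: n; exact: upx.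
have : birkhoff_sum (fun z => K - g z) n x <= (K - c + m.+1%:R^-1) * n%:R.
  by near: n; exact: lox.
rewrite /birkhoff_sum !big_split /= sumrN sumr_const card_ord -[K *+ n]mulr_natr.
set S := \sum_(i < n) _ => H1 H2.
have me' : m.+1%:R^-1 * n%:R <= e * n%:R by rewrite ler_pM2r.
have -> : c - S / n%:R = (c * n%:R - S) / n%:R.
  by rewrite mulrBl mulfK// gt_eqF.
rewrite normrM normfV (gtr0_norm n0) ler_pdivrMr// ler_norml.
move: H1 H2 me' {n0}; move: (m.+1%:R^-1) (n%:R : R) S => a b S H1 H2 H3.
by apply/andP; split; lra.
Unshelve. all: by end_near. Qed.

End ergodic_averages.

Definition cylinders (R : realType) (I : Type) : set (set (int -> I -> R)) :=
  [set C | exists t i (B : set R),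
     measurable B /\ C = [set x : int -> I -> R | B (x t i)]].

Definition path_space (R : realType) (I : Type) :=
  g_sigma_algebraType (@cylinders R I).

Definition path_shift {R : realType} {I : Type} (x : path_space R I) :
  path_space R I := fun t => x (t + 1).

Section path_space.
Context {R : realType} {I : Type}.

Lemma measurable_coordinate t (i : I) :
  measurable_fun setT (fun x : path_space R I => x t i).
Proof.
move=> _ B mB; rewrite setTI; apply: sub_sigma_algebra.
by exists t, i, B.
Qed.

Lemma measurable_into_path_space d (T : measurableType d)
    (f : T -> path_space R I) :
  (forall t i, measurable_fun setT (fun w => f w t i)) -> measurable_fun setT f.
Proof.
move=> mf; apply: (@measurability _ _ T (path_space R I) setT f (@cylinders R I)) => // _ [_ [t [i [B [mB ->]]]] <-].
exact: mf.
Qed.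

Lemma measurable_path_shift : measurable_fun setT (@path_shift R I).
Proof. by apply: measurable_into_path_space => t i; exact: measurable_coordinate. Qed.

Lemma iter_path_shift n (x : path_space R I) t : iter n path_shift x t = x (t + n%:Z).
Proof.
elim: n t => [|n IH] t /=; first by rewrite addr0.
by rewrite /path_shift IH -addrA -PoszD add1n.
Qed.

Context {dT : measure_display} {T : measurableType dT} (P : probability T R).
Variable X : int -> T -> I -> R.
Hypothesis statX : stationary P X.

Let path (w : T) : path_space R I := fun t => X t w.

Let mpath : measurable_fun setT path.
Proof. by apply: measurable_into_path_space; case: statX. Qed.

HB.instance Definition _ := isMeasurableFun.Build _ _ _ _ path mpath.

Let law : probability (path_space R I) R := distribution P path.

Let law_shift A : measurable A -> law (path_shift @^-1` A) = law A.
Proof. by move=> mA; have [_ /(_ _ mA)] := statX. Qed.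

Lemma stationary_integral (f : (I -> R) -> \bar R) (n : nat) :
  measurable_fun setT (fun x : path_space R I => f (x 0)) ->
  (forall y, (0 <= f y)%E) ->
  (\int[P]_w f (X n%:Z w) = \int[P]_w f (X 0 w))%E.
Proof.
move=> mf f0.
have := integral_iterate measurable_path_shift law_shift n mf (fun=> f0 _).
rewrite !ge0_integral_distribution//=.
- by under eq_integral do rewrite iter_path_shift add0r.
- exact: (measurableT_comp mf (measurable_iterate measurable_path_shift n)).
Qed.

Lemma ergodic_average (g : (I -> R) -> R) (K : R) : ergodic P X ->
  measurable_fun setT (fun x : path_space R I => g (x 0)) ->
  (forall y, `|g y| <= K) ->
  {ae P, forall w, (\sum_(1 <= t < n.+1) g (X t%:Z w)) / n%:R @[n --> \oo] -->
    \int[P]_w g (X 0 w)}.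
Proof.
move=> ergX mg gK.
have lawE A : measurable A -> (forall x, A (path_shift x) <-> A x) ->
    law A = 0%E \/ law A = 1%E.
  by move=> mA invA; apply: ergX.
have mg1 : measurable_fun setT (fun x : path_space R I => g (x 1)).
  have := measurableT_comp mg measurable_path_shift.
  by apply: eq_measurable_fun => x _; rewrite /= /path_shift add0r.
have [N [mN N0 HN]] := birkhoff_bounded measurable_path_shift law_shift lawE mg1
  (fun=> gK _).
exists (path @^-1` N); split => //; first by rewrite -[X in measurable X]setTI; exact: mpath.
move=> w nw; apply: HN => H; apply: nw; move: H.
have -> : \int[law]_z g (z 1) = \int[P]_w g (X 0 w).
  have H (f : (I -> R) -> \bar R) : (forall y, 0 <= f y)%E ->
      measurable_fun setT (fun x : path_space R I => f (x 0)) ->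
      (\int[law]_z f (z 1%R) = \int[P]_w f (X 0%R w))%E.
    move=> f0 mf; rewrite -(stationary_integral 1)// ge0_integral_distribution//=.
    have := measurableT_comp mf measurable_path_shift.
    by apply: eq_measurable_fun => x _; rewrite /= /path_shift add0r.
  pose gp (y : I -> R) := (g y)%:E.
  have mgp : measurable_fun setT (fun x : path_space R I => gp (x 0)).
    exact/measurable_EFinP.
  rewrite /Rintegral; congr fine; rewrite [LHS]integralE [RHS]integralE.
  congr (_ - _)%E.
    have fE U (h : U -> I -> R) : (fun z => (g (h z))%:E)^\+%E = (fun z => gp^\+%E (h z)).
      by apply/funext => z; rewrite !unlock.
    rewrite !fE; apply: H => //.
    have -> : (fun x : path_space R I => gp^\+%E (x (0 : int)%R)) = (fun x : path_space R I => gp (x (0 : int)%R))^\+%E.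
      by apply/funext => z; rewrite !unlock.
    exact: measurable_funepos.
  have fE U (h : U -> I -> R) : (fun z => (g (h z))%:E)^\-%E = (fun z => gp^\-%E (h z)).
    by apply/funext => z; rewrite !unlock.
  rewrite !fE; apply: H => //.
  have -> : (fun x : path_space R I => gp^\-%E (x (0 : int)%R)) = (fun x : path_space R I => gp (x (0 : int)%R))^\-%E.
    by apply/funext => z; rewrite !unlock.
  exact: measurable_funeneg.
apply: cvg_trans; apply: near_eq_cvg; apply: nearW => n.
rewrite big_add1 /= big_mkord; congr (_ / _); apply: eq_bigr => i _.
by rewrite iter_path_shift -PoszD add1n.
Qed.
End path_space.

(** * Measurability *)

Lemma measurable_countable_choice {R : realType} {d : measure_display}
    {T : measurableType d} (C : countType) (z : T -> C) (h : C -> T -> R) :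
  (forall c, measurable (z @^-1` [set c])) ->
  (forall c, measurable_fun setT (h c)) ->
  measurable_fun setT (fun w => h (z w) w).
Proof.
move=> mz mh _ B mB; rewrite setTI.
have -> : (fun w => h (z w) w) @^-1` B =
    \bigcup_c (z @^-1` [set c] `&` h c @^-1` B).
  apply/seteqP; split => [w Bw|w [c _ [/= <-]]] //.
  by exists (z w).
apply: countable_bigcupT_measurable; first exact: countableP.
move=> c; apply: measurableI => //.
by rewrite -[X in measurable X]setTI; exact: mh.
Qed.

Definition grid {R : realType} {d} (k : nat) (x : 'cV[R]_d) : 'cV[int]_d :=
  \col_i Num.floor (k.+1%:R * x i 0).

Definition grid_point {R : realType} {d} (k : nat) (c : 'cV[int]_d) : 'cV[R]_d :=
  \col_i ((c i 0)%:~R / k.+1%:R).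

Lemma grid_bounds {R : realType} {d} (k : nat) (x : 'cV[R]_d) i :
  (grid_point k (grid k x) : 'cV[R]_d) i 0 <= x i 0 <
    (grid_point k (grid k x) : 'cV[R]_d) i 0 + k.+1%:R^-1.
Proof.
have k0 : 0 < k.+1%:R :> R by [].
rewrite !mxE ler_pdivrMr// mulrC -{2}[k.+1%:R^-1]mul1r -mulrDl ltr_pdivlMr//.
have := floor_itv (k.+1%:R * x i 0).
by rewrite intrD1 [x i 0 * _]mulrC => /andP[-> ->].
Qed.

Lemma grid_dist {R : realType} {d} (k : nat) (x y : 'cV[R]_d) :
  grid k x = grid k y -> `|x - y| <= k.+1%:R^-1.
Proof.
move=> xy; apply: norm_mx_le => // i j; rewrite ord1 !mxE.
have := grid_bounds k x i; have := grid_bounds k y i; rewrite xy.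
rewrite ler_distlC; move: (k.+1%:R^-1) => b /andP[? ?] /andP[? ?].
by apply/andP; split; lra.
Qed.

Lemma grid_point_cvg {R : realType} {d} (x : 'cV[R]_d) :
  (grid_point k (grid k x) : 'cV[R]_d) @[k --> \oo] --> x.
Proof.
apply/cvgrPdist_le => e e0; near=> k.
have ke : k.+1%:R^-1 <= e.
  near: k; have /cvgrPdist_le /(_ _ e0) := @cvg_harmonic R.
  apply: filterS => k /=; rewrite /harmonic sub0r normrN; apply: le_trans; exact: ler_norm.
apply: norm_mx_le (ltW e0) _ => i j; rewrite ord1.
have := grid_bounds k x i; move: ke; move: (grid_point _ _) => G.
have -> : (x - G) i 0 = x i 0 - G i 0 by rewrite !mxE.
move: (G i 0) (k.+1%:R^-1) => a b be /andP[? ?].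
by rewrite ger0_norm; lra.
Unshelve. all: by end_near. Qed.

Section random_points.
Context {R : realType} {dT : measure_display} {T : measurableType dT} {d : nat}.
Variable xi : T -> 'cV[R]_d.
Hypothesis mxi : forall i, measurable_fun setT (fun w => xi w i 0).

Lemma measurable_grid k (c : 'cV[int]_d) :
  measurable ((fun w => grid k (xi w)) @^-1` [set c]).
Proof.
have -> : (fun w => grid k (xi w)) @^-1` [set c] =
   \bigcap_(i in [set: 'I_d]) (fun w => Num.floor (k.+1%:R * xi w i 0)) @^-1` [set c i 0].
  apply/seteqP; split => [w /= <- i _ /=|w H]; first by rewrite mxE.
  by apply/matrixP => i j; rewrite ord1 mxE; exact: H.
apply: fin_bigcap_measurable; first exact: finite_finset.
move=> i _; set r := fun w => k.+1%:R * xi w i 0.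
have -> : (fun w => Num.floor (r w)) @^-1` [set c i 0] =
    r @^-1` `[(c i 0)%:~R, (c i 0 + 1)%:~R[%classic.
  apply/seteqP; split => w /=; rewrite in_itv /=.
    by move=> <-; exact: floor_itv.
  exact: floor_def.
rewrite -[X in measurable X]setTI.
have : measurable_fun setT r by exact: measurable_funM.
by apply; [exact: measurableT|exact: measurable_itv].
Qed.

Lemma measurable_grid_eval (f : T -> 'cV[R]_d -> R) k (a : 'cV[R]_d) :
  (forall x, measurable_fun setT (fun w => f w x)) ->
  measurable_fun setT (fun w => f w (grid_point k (grid k (xi w)) + a)).
Proof.
move=> mf.
apply: (@measurable_countable_choice _ _ _ _ (fun w => grid k (xi w))
  (fun c w => f w (grid_point k c + a))) => [c|c]; first exact: measurable_grid.
exact: mf.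
Qed.

Lemma measurable_partial_at (f : T -> 'cV[R]_d -> R) (i : 'I_d) :
  (forall x, measurable_fun setT (fun w => f w x)) ->
  (forall w, C1_on [set xi w] (f w)) ->
  measurable_fun setT (fun w => partial i (f w) (xi w)).
Proof.
move=> mf f1; apply: measurable_fun_cvg => [m|w _]; last first.
  apply: (@partial_quotient_cvg R d (f w) (xi w)
     (fun k => grid_point k (grid k (xi w))) harmonic i) => //.
  - exact: grid_point_cvg.
  - exact: cvg_harmonic.
  - exact: harmonic_neq0.
apply: measurable_funM => //; apply: measurable_funB.
  exact: measurable_grid_eval.
under eq_fun do rewrite -[grid_point _ _]addr0.
exact: measurable_grid_eval.
Qed.

Lemma measurable_hessian_at (f : T -> 'cV[R]_d -> R) (i j : 'I_d) :
  (forall x, measurable_fun setT (fun w => f w x)) ->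
  (forall w, C2_on [set xi w] (f w)) ->
  measurable_fun setT (fun w => hessian (f w) (xi w) i j).
Proof.
move=> mf f2; apply: measurable_fun_cvg => [m|w _]; last first.
  apply: (@hessian_quotient_cvg R d (f w) (xi w)
     (fun k => grid_point k (grid k (xi w))) harmonic i j) => //.
  - exact: grid_point_cvg.
  - exact: cvg_harmonic.
  - exact: harmonic_neq0.
apply: measurable_funM => //; apply: measurable_funB; apply: measurable_funB.
- by under eq_fun do rewrite -addrA; exact: measurable_grid_eval.
- exact: measurable_grid_eval.
- exact: measurable_grid_eval.
under eq_fun do rewrite -[grid_point _ _]addr0.
exact: measurable_grid_eval.
Qed.

End random_points.

Lemma countable_dense_sequence {R : realType} {d} (A : set 'cV[R]_d) : A !=set0 ->
  exists2 D : nat -> 'cV[R]_d, (forall k, A (D k)) &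
    forall x e, A x -> 0 < e -> exists k, `|x - D k| <= e.
Proof.
move=> [x0 Ax0].
have /choice[p Hp] : forall c : nat * 'cV[int]_d, exists y, A y /\
    ((exists2 x, A x & grid c.1 x = c.2) -> grid c.1 y = c.2).
  move=> c.
  have [[x Ax xc]|nx] := pselect (exists2 x, A x & grid c.1 x = c.2).
    by exists x.
  by exists x0.
exists (fun n => if unpickle n is Some c then p c else x0) => [k|x e Ax e0].
  by case: (unpickle k) => // c; case: (Hp c).
have [k ke] : exists k, k.+1%:R^-1 <= e.
  have [k ek] := exists_natr_gt e^-1.
  exists k; rewrite -[leRHS]invrK lef_pV2 ?posrE ?invr_gt0//.
  by rewrite (le_trans (ltW ek))// ler_nat.
exists (pickle (k, grid k x)); rewrite pickleK; apply: le_trans ke.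
by apply: grid_dist; have [_ /= ->//] := Hp (k, grid k x); exists x.
Qed.

Lemma mxnorm1_leP {R : realType} p q (A : 'M[R]_(p, q)) (c : R) : 0 <= c ->
  (forall j, \sum_i `|A i j| <= c) -> mxnorm1 A <= c.
Proof. by move=> c0 Ac; apply/bigmax_leP; split. Qed.

Lemma mxnorm1_col_le {R : realType} p q (A : 'M[R]_(p, q)) j :
  \sum_i `|A i j| <= mxnorm1 A.
Proof. by apply/bigmax_geP; right; exists j. Qed.

Lemma mxnorm1_ge0 {R : realType} p q (A : 'M[R]_(p, q)) : 0 <= mxnorm1 A.
Proof. by apply/bigmax_geP; left. Qed.

Lemma entry_le_mxnorm1 {R : realType} p q (A : 'M[R]_(p, q)) i j :
  `|A i j| <= mxnorm1 A.
Proof.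
apply: le_trans (mxnorm1_col_le A j); rewrite (bigD1 i)//= lerDl.
exact: sumr_ge0.
Qed.

Lemma mxnorm1_le_dist {R : realType} p q (A B : 'M[R]_(p, q)) :
  mxnorm1 A <= mxnorm1 B + p%:R * `|A - B|.
Proof.
apply: mxnorm1_leP => [|j]; first by rewrite addr_ge0// ?mxnorm1_ge0// mulr_ge0.
apply: (@le_trans _ _ (\sum_i `|B i j| + \sum_(i < p) `|A - B|)).
  rewrite -big_split /=; apply: ler_sum => i _.
  have -> : A i j = B i j + (A - B) i j by rewrite !mxE; ring.
  by rewrite (le_trans (ler_normD _ _))// lerD2l norm_coord_le.
rewrite sumr_const card_ord mulr_natl lerD2r; exact: mxnorm1_col_le.
Qed.

Lemma le_supnorm {R : realType} {d p q} (A : set 'cV[R]_d)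
    (g : 'cV[R]_d -> 'M[R]_(p, q)) x : A x -> ((mxnorm1 (g x))%:E <= supnorm A g)%E.
Proof. by move=> Ax; apply: ereal_sup_ubound; exists x. Qed.

Lemma supnorm_ge0 {R : realType} {d p q} (A : set 'cV[R]_d)
    (g : 'cV[R]_d -> 'M[R]_(p, q)) : A !=set0 -> (0 <= supnorm A g)%E.
Proof.
move=> [x Ax]; apply: le_trans (le_supnorm g Ax).
by rewrite lee_fin mxnorm1_ge0.
Qed.

Lemma supnorm_dense {R : realType} {d p q} (A : set 'cV[R]_d) (D : nat -> 'cV[R]_d)
    (g : 'cV[R]_d -> 'M[R]_(p, q)) :
  (forall k, A (D k)) ->
  (forall x e, A x -> 0 < e -> exists k, `|x - D k| <= e) ->
  (forall x, A x -> {for x, continuous g}) ->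
  supnorm A g = ereal_sup (range (fun k => (mxnorm1 (g (D k)))%:E)).
Proof.
move=> AD dD cg; apply/eqP; rewrite eq_le; apply/andP; split; last first.
  by apply: ge_ereal_sup => _ [k _ <-]; apply: le_supnorm.
apply: ge_ereal_sup => _ [x Ax <-].
apply/lee_addgt0Pr => e e0.
have pe : 0 < e / p.+1%:R by rewrite divr_gt0.
have /cvgrPdist_le /(_ _ pe) /nbhs_normP[r /= r0 Hr] := cg _ Ax.
have r2 : 0 < r / 2 by rewrite divr_gt0.
have [k xk] := dD _ _ Ax r2.
have /= H : `|g x - g (D k)| <= e / p.+1%:R.
  by apply: Hr => /=; rewrite (le_lt_trans xk)//; lra.
apply: (@le_trans _ _ ((mxnorm1 (g (D k)))%:E + e%:E)%E).
  rewrite -EFinD lee_fin (le_trans (mxnorm1_le_dist _ (g (D k))))// lerD2l.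
  apply: (@le_trans _ _ (p.+1%:R * (e / p.+1%:R))).
    by rewrite ler_pM// ler_nat.
  by rewrite mulrC divfK.
by apply: leeD2r; apply: ereal_sup_ubound; exists k.
Qed.

Lemma measurable_mxnorm1 {R : realType} {d} {T : measurableType d} p q
    (A : T -> 'M[R]_(p, q)) :
  (forall i j, measurable_fun setT (fun w => A w i j)) ->
  measurable_fun setT (fun w => mxnorm1 (A w)).
Proof.
move=> mA; rewrite /mxnorm1; elim: (index_enum _) => [|j s IH].
  by under eq_fun do rewrite big_nil; exact: measurable_cst.
under eq_fun do rewrite big_cons; apply: measurable_maxr => //.
by apply: measurable_sum => i; exact: measurableT_comp.
Qed.

Lemma measurable_ereal_sup_range {R : realType} {d} {T : measurableType d}
    (h : nat -> T -> \bar R) :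
  (forall k, measurable_fun setT (h k)) ->
  measurable_fun setT (fun w => ereal_sup (range (fun k => h k w))).
Proof.
move=> mh; have := measurable_fun_esups mh 0; apply: eq_measurable_fun => w _.
by rewrite /esups /sdrop; congr ereal_sup; apply/seteqP; split => _ [k _ <-]; exists k.
Qed.

Lemma measurable_supnorm {R : realType} {dT} {T : measurableType dT} {d p q}
    (A : set 'cV[R]_d) (g : T -> 'cV[R]_d -> 'M[R]_(p, q)) : A !=set0 ->
  (forall x i j, A x -> measurable_fun setT (fun w => g w x i j)) ->
  (forall w x, A x -> {for x, continuous (g w)}) ->
  measurable_fun setT (fun w => supnorm A (g w)).
Proof.
move=> A0 mg cg; have [D AD dD] := countable_dense_sequence A0.
under eq_fun do rewrite (supnorm_dense AD dD (cg _)).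
apply: measurable_ereal_sup_range => k; apply/measurable_EFinP.
by apply: measurable_mxnorm1 => i j; apply: mg.
Qed.

Lemma measurable_invr {R : realType} {d} {T : measurableType d} (f : T -> R) :
  measurable_fun setT f -> measurable_fun setT (fun w => (f w)^-1).
Proof.
move=> mf.
have den (m : nat) (x : R) : x ^+ 2 + m.+1%:R^-1 != 0.
  by rewrite gt_eqF// ltr_wpDl// ?sqr_ge0.
have mh m : measurable_fun setT (fun x : R => (x ^+ 2 + m.+1%:R^-1)^-1).
  apply: continuous_measurable_fun => x; apply: cvgV; first exact: den.
  by apply: cvgD; [exact: exprn_continuous|exact: cvg_cst].
apply: (@measurable_fun_cvg _ _ _ _ (fun m w => f w * (f w ^+ 2 + m.+1%:R^-1)^-1)).
  by move=> m; apply: measurable_funM => //; exact: (measurableT_comp (mh m) mf).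
move=> w _; have [->|fw] := eqVneq (f w) 0.
  by rewrite invr0; under eq_fun do rewrite mul0r; exact: cvg_cst.
rewrite -[X in _ --> X](_ : f w * (f w ^+ 2 + 0)^-1 = _); last first.
  by rewrite addr0 expr2 invfM mulrA mulfV// mul1r.
apply: cvgM; first exact: cvg_cst.
apply: cvgV; first by rewrite addr0 expf_neq0.
by apply: cvgD; [exact: cvg_cst|exact: cvg_harmonic].
Qed.

Section measurable_matrices.
Context {R : realType} {dT : measure_display} {T : measurableType dT}.

Definition measurable_mx {p q} (A : T -> 'M[R]_(p, q)) :=
  forall i j, measurable_fun setT (fun w => A w i j).

Lemma measurable_mxD p q (A B : T -> 'M[R]_(p, q)) :
  measurable_mx A -> measurable_mx B -> measurable_mx (fun w => A w + B w).
Proof.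
by move=> mA mB i j; under eq_fun do rewrite mxE; exact: measurable_funD.
Qed.

Lemma measurable_mxB p q (A B : T -> 'M[R]_(p, q)) :
  measurable_mx A -> measurable_mx B -> measurable_mx (fun w => A w - B w).
Proof.
by move=> mA mB i j; under eq_fun do rewrite !mxE; exact: measurable_funB.
Qed.

Lemma measurable_mxZ p q (a : R) (A : T -> 'M[R]_(p, q)) :
  measurable_mx A -> measurable_mx (fun w => a *: A w).
Proof.
by move=> mA i j; under eq_fun do rewrite mxE; exact: measurable_funM.
Qed.

Lemma measurable_mxM p q r (A : T -> 'M[R]_(p, q)) (B : T -> 'M[R]_(q, r)) :
  measurable_mx A -> measurable_mx B -> measurable_mx (fun w => A w *m B w).
Proof.
move=> mA mB i j; under eq_fun do rewrite mxE.
by apply: measurable_sum => k; exact: measurable_funM.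
Qed.

Lemma measurable_mx_tr p q (A : T -> 'M[R]_(p, q)) :
  measurable_mx A -> measurable_mx (fun w => (A w)^T).
Proof. by move=> mA i j; under eq_fun do rewrite mxE; exact: mA. Qed.

Lemma measurable_mx_sum p q (l l' : nat) (A : nat -> T -> 'M[R]_(p, q)) :
  (forall t, (l <= t < l')%N -> measurable_mx (A t)) ->
  measurable_mx (fun w => \sum_(l <= t < l') A t w).
Proof.
move=> mA i j.
have E w : (\sum_(l <= t < l') A t w) i j =
    \sum_(l <= t < l') (if (l <= t < l')%N then A t w i j else 0).
  by rewrite summxE big_nat big_mkcond.
under eq_fun do rewrite E; apply: measurable_sum => t.
by case tl : (l <= t < l')%N => //; exact: mA.
Qed.

Lemma measurable_det n (A : T -> 'M[R]_n) :
  measurable_mx A -> measurable_fun setT (fun w => \det (A w)).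
Proof.
move=> mA; rewrite /determinant; apply: measurable_sum => s.
apply: measurable_funM => //; apply: measurable_prod => i _; exact: mA.
Qed.

Lemma measurable_invmx n (A : T -> 'M[R]_n) :
  measurable_mx A -> measurable_mx (fun w => invmx (A w)).
Proof.
move=> mA i j.
have E w : invmx (A w) i j =
    if \det (A w) == 0 then A w i j else (\det (A w))^-1 * cofactor (A w) j i.
  by rewrite /invmx unitmxE unitfE; case: eqP => //= _; rewrite !mxE.
under eq_fun do rewrite E.
apply: measurable_fun_ifT; first by apply: measurable_fun_eqr => //; exact: measurable_det.
  exact: mA.
apply: measurable_funM; first by apply: measurable_invr; exact: measurable_det.
apply: measurable_funM => //; apply: measurable_det => k l.
by under eq_fun do rewrite !mxE; exact: mA.
Qed.

End measurable_matrices.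

(** * Gram matrices and the quadratic form of the statistic *)

Definition qform {R : realType} {d} (A : 'M[R]_d) (x : 'cV[R]_d) : R :=
  (x^T *m A *m x) 0 0.

Definition sqnorm {R : realType} {d} (x : 'cV[R]_d) : R := (x^T *m x) 0 0.

Lemma sqnormE {R : realType} {d} (x : 'cV[R]_d) : sqnorm x = \sum_i x i 0 ^+ 2.
Proof. by rewrite /sqnorm mxE; apply: eq_bigr => i _; rewrite mxE expr2. Qed.

Lemma sqnorm_ge0 {R : realType} {d} (x : 'cV[R]_d) : 0 <= sqnorm x.
Proof. by rewrite sqnormE sumr_ge0// => i _; rewrite sqr_ge0. Qed.

Lemma sqnorm_gt0 {R : realType} {d} (x : 'cV[R]_d) : x != 0 -> 0 < sqnorm x.
Proof.
move=> x0; rewrite lt_def sqnorm_ge0 andbT; apply: contra x0 => /eqP.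
rewrite sqnormE => /psumr_eq0P H; apply/eqP/matrixP => i j; rewrite ord1 mxE.
by apply/eqP; rewrite -sqrf_eq0; apply/eqP/H => // k _; exact: sqr_ge0.
Qed.

Lemma sqnorm_norm {R : realType} {d} (x : 'cV[R]_d) : `|x| ^+ 2 <= sqnorm x.
Proof.
have s0 := sqnorm_ge0 x.
rewrite -ler_sqrt// sqrtr_sqr normr_id; apply: norm_mx_le => [|i j].
  exact: sqrtr_ge0.
rewrite ord1 -sqrtr_sqr ler_sqrt// sqnormE (bigD1 i)//= lerDl.
by apply: sumr_ge0 => k _; exact: sqr_ge0.
Qed.

Lemma mxnorm1_col {R : realType} {d} (x : 'cV[R]_d) : mxnorm1 x = \sum_i `|x i 0|.
Proof.
apply/eqP; rewrite eq_le mxnorm1_col_le andbT; apply: mxnorm1_leP => [|j].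
  exact: sumr_ge0.
by rewrite ord1.
Qed.

Lemma mxnorm1_triangle {R : realType} p q (A B : 'M[R]_(p, q)) :
  mxnorm1 (A + B) <= mxnorm1 A + mxnorm1 B.
Proof.
apply: mxnorm1_leP => [|j]; first by rewrite addr_ge0// mxnorm1_ge0.
apply: (@le_trans _ _ (\sum_i (`|A i j| + `|B i j|))).
  by apply: ler_sum => i _; rewrite mxE ler_normD.
by rewrite big_split lerD// mxnorm1_col_le.
Qed.

Lemma dot_bound {R : realType} {d} (a x : 'cV[R]_d) :
  (a^T *m x) 0 0 ^+ 2 <= mxnorm1 a ^+ 2 * sqnorm x.
Proof.
apply: (@le_trans _ _ ((mxnorm1 a * `|x|) ^+ 2)); last first.
  by rewrite exprMn ler_wpM2l ?sqr_ge0// sqnorm_norm.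
rewrite -real_normK ?num_real// lerXn2r ?nnegrE ?mulr_ge0 ?mxnorm1_ge0//.
rewrite mxE mxnorm1_col mulr_suml (le_trans (ler_norm_sum _ _ _))//.
by apply: ler_sum => i _; rewrite mxE normrM ler_wpM2l// norm_coord_le.
Qed.

Section gram.
Context {R : realType} {d : nat}.
Implicit Types (a : nat -> 'cV[R]_d) (x : 'cV[R]_d).

Definition gram (l l' : nat) a : 'M[R]_d := \sum_(l <= t < l') a t *m (a t)^T.

Lemma qform_gram l l' a x :
  qform (gram l l' a) x = \sum_(l <= t < l') ((a t)^T *m x) 0 0 ^+ 2.
Proof.
rewrite /qform /gram mulmx_sumr mulmx_suml summxE; apply: eq_bigr => t _.
rewrite mulmxA -mulmxA mxE big_ord1 expr2; congr (_ * _).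
by rewrite -[in RHS](trmxK x) -trmx_mul [RHS]mxE.
Qed.

Lemma gram_tr l l' a : (gram l l' a)^T = gram l l' a.
Proof.
rewrite /gram linear_sum; apply: eq_bigr => t _.
by rewrite /= trmx_mul trmxK.
Qed.

Lemma qformZ (c : R) (A : 'M[R]_d) x : qform (c *: A) x = c * qform A x.
Proof. by rewrite /qform -scalemxAr -scalemxAl mxE. Qed.

Lemma qform_gram_ge0 l l' a x : 0 <= qform (gram l l' a) x.
Proof. by rewrite qform_gram sumr_ge0// => t _; exact: sqr_ge0. Qed.

Lemma sum_sqr_le (l l' : nat) (b : nat -> R) : (forall t, 0 <= b t) ->
  \sum_(l <= t < l') b t ^+ 2 <= (\sum_(l <= t < l') b t) ^+ 2.
Proof.
move=> b0; elim: (index_iota l l') => [|t s IH]; first by rewrite !big_nil expr0n.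
rewrite !big_cons sqrrD -addrA lerD2l (le_trans IH)// lerDr mulrn_wge0//.
by rewrite mulr_ge0// sumr_ge0.
Qed.

Lemma qform_gram_le l l' a x :
  qform (gram l l' a) x <= (\sum_(l <= t < l') mxnorm1 (a t)) ^+ 2 * sqnorm x.
Proof.
rewrite qform_gram; apply: le_trans (ler_wpM2r (sqnorm_ge0 x) (sum_sqr_le _ _ _)).
  by rewrite mulr_suml; apply: ler_sum => t _; exact: dot_bound.
by move=> t; exact: mxnorm1_ge0.
Qed.

(* The null vectors of a Gram matrix only depend on the lines spanned. *)
Lemma gram_unitmx l l' a (s : nat -> R) :
  gram l l' (fun t => s t *: a t) \in unitmx -> gram l l' a \in unitmx.
Proof.
rewrite !unitmxE !unitfE; apply: contra => /det0P[v v0 va].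
apply/det0P; exists v => //.
have /eqP : \sum_(l <= t < l') ((a t)^T *m v^T) 0 0 ^+ 2 = 0.
  by rewrite -qform_gram /qform trmxK va mul0mx mxE.
rewrite psumr_eq0 => [/allP H|t _]; last exact: sqr_ge0.
rewrite /gram mulmx_sumr big_seq big1// => t /H /=; rewrite sqrf_eq0 => /eqP {}H.
rewrite -scalemxAl -scalemxAr mulmxA.
have -> : v *m a t = 0.
  apply/matrixP => i j; rewrite !ord1 [RHS]mxE -H.
  by rewrite -[in RHS](trmxK (a t)) trmxK -trmx_mul [RHS]mxE.
by rewrite mul0mx !scaler0.
Qed.

Lemma invmx_tr_sym (A : 'M[R]_d) : A^T = A -> (invmx A)^T = invmx A.
Proof. by move=> AT; rewrite trmx_inv AT. Qed.

Lemma qform_invmx_ge0 (A : 'M[R]_d) x : A^T = A ->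
  (forall y, 0 <= qform A y) -> 0 <= qform (invmx A) x.
Proof.
move=> AT A0; have [Au|nAu] := boolP (A \in unitmx); last first.
  by rewrite /invmx (negbTE nAu).
have := A0 (invmx A *m x); rewrite /qform trmx_mul invmx_tr_sym//.
by rewrite -[in X in X -> _]mulmxA [A *m _]mulmxA mulmxV// mul1mx.
Qed.

Lemma qform_invmx_ge (A : 'M[R]_d) (b : R) x : A^T = A -> A \in unitmx -> 0 < b ->
  (forall y, 0 <= qform A y <= b * sqnorm y) -> sqnorm x / b <= qform (invmx A) x.
Proof.
move=> AT Au b0 A0.
set z := invmx A *m x.
have Az : A *m z = x by rewrite /z mulmxA mulmxV// mul1mx.
have zA : z^T *m A = x^T by rewrite -[X in _ *m X]AT -trmx_mul Az.
have zz : qform A z = qform (invmx A) x.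
  by rewrite /qform zA /z mulmxA.
have := A0 (z - b^-1 *: x) => /andP[+ _].
have -> : qform A (z - b^-1 *: x) =
    qform A z - 2 * b^-1 * sqnorm x + b^-1 ^+ 2 * qform A x.
  rewrite /qform; have -> : (z - b^-1 *: x)^T = z^T - b^-1 *: x^T.
    by rewrite linearB /= linearZ.
  have entB (B C : 'M[R]_1) : (B - C) 0 0 = B 0 0 - C 0 0 by rewrite !mxE.
  have entZ (r : R) (B : 'M[R]_1) : (r *: B) 0 0 = r * B 0 0 by rewrite mxE.
  rewrite !mulmxBl !mulmxBr -!scalemxAl zA.
  rewrite -!scalemxAr -[x^T *m A *m z]mulmxA Az !entB !entZ -/(sqnorm x).
  by rewrite -zA; ring.
have /andP[_ Ax] := A0 x.
rewrite zz => H.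
have bx : b^-1 ^+ 2 * qform A x <= b^-1 * sqnorm x.
  apply: (@le_trans _ _ (b^-1 ^+ 2 * (b * sqnorm x))).
    by rewrite ler_wpM2l// exprn_ge0// invr_ge0 ltW.
  by rewrite mulrA expr2 mulfVK// gt_eqF.
rewrite mulrC; move: H bx; move: (b^-1) => c; lra.
Qed.

End gram.

Lemma Ghat_gram {R : realType} {d} (c : nat -> 'cV[R]_d -> R) th l l' :
  Ghat c th l l' = (l' - l + 1)%N%:R^-1 *:
    gram l l'.+1 (fun t => gradient (c t) (th l l')).
Proof. by []. Qed.

Lemma Ghat_tr {R : realType} {d} (c : nat -> 'cV[R]_d -> R) th l l' :
  (Ghat c th l l')^T = Ghat c th l l'.
Proof. by rewrite Ghat_gram linearZ /= gram_tr. Qed.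

Lemma qform_Ghat_ge0 {R : realType} {d} (c : nat -> 'cV[R]_d -> R) th l l' x :
  0 <= qform (Ghat c th l l') x.
Proof. by rewrite Ghat_gram qformZ mulr_ge0 ?invr_ge0// qform_gram_ge0. Qed.

Lemma Fhat_tr {R : realType} {d} (c : nat -> 'cV[R]_d -> R) th l l' :
  (forall t, (l <= t <= l')%N -> C2_on [set th l l'] (c t)) ->
  (Fhat c th l l')^T = Fhat c th l l'.
Proof.
move=> c2; rewrite /Fhat linearZ /= linear_sum /=; congr (_ *: _).
by apply: eq_big_nat => t tl; apply: hessian_sym; apply: c2.
Qed.

Lemma qform_sandwich {R : realType} {d} (F A : 'M[R]_d) (x : 'cV[R]_d) : F^T = F ->
  qform (F *m A *m F) x = qform A (F *m x).
Proof. by move=> FT; rewrite /qform trmx_mul FT !mulmxA. Qed.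

Lemma qform_half_sum_ge {R : realType} {d} (F1 G1 F2 G2 : 'M[R]_d) (b : R)
    (x : 'cV[R]_d) :
  F1^T = F1 -> F2^T = F2 -> G1^T = G1 -> G2^T = G2 -> G1 \in unitmx -> 0 < b ->
  (forall y, 0 <= qform G1 y <= b * sqnorm y) -> (forall y, 0 <= qform G2 y) ->
  sqnorm (F1 *m x) / (2 * b) <=
    qform (2%:R^-1 *: (F1 *m invmx G1 *m F1 + F2 *m invmx G2 *m F2)) x.
Proof.
move=> F1T F2T G1T G2T G1u b0 G1b G2p; rewrite qformZ.
have -> (A B : 'M[R]_d) : qform (A + B) x = qform A x + qform B x.
  by rewrite /qform mulmxDr mulmxDl mxE.
rewrite (qform_sandwich _ _ F1T) (qform_sandwich _ _ F2T).
rewrite invfM mulrCA ler_wpM2l ?invr_ge0 ?ler0n//.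
rewrite (le_trans (qform_invmx_ge (F1 *m x) G1T G1u b0 G1b))// lerDl.
exact: qform_invmx_ge0.
Qed.

Lemma qform_Omegahat_ge {R : realType} {d} (c : nat -> 'cV[R]_d -> R) th n u (b : R)
    (x : 'cV[R]_d) :
  (forall t, (1 <= t <= u)%N -> C2_on [set th 1 u] (c t)) ->
  (forall t, (u.+1 <= t <= n)%N -> C2_on [set th u.+1 n] (c t)) ->
  Ghat c th 1 u \in unitmx -> 0 < b ->
  (forall y, qform (Ghat c th 1 u) y <= b * sqnorm y) ->
  sqnorm (Fhat c th 1 u *m x) / (2 * b) <= qform (Omegahat c th n u) x.
Proof.
move=> c1 c2 Gu b0 Gb; apply: qform_half_sum_ge => //.
- exact: Fhat_tr.
- exact: Fhat_tr.
- exact: Ghat_tr.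
- exact: Ghat_tr.
- by move=> y; rewrite qform_Ghat_ge0 Gb.
- by move=> y; exact: qform_Ghat_ge0.
Qed.

Section normalization.
Context {R : realType} {d : nat}.
Implicit Types a b : 'cV[R]_d.

Definition normalize a : 'cV[R]_d := (1 + mxnorm1 a)^-1 *: a.

Lemma normalize_le1 a i : `|normalize a i 0| <= 1.
Proof.
have a0 := mxnorm1_ge0 a.
have a1 : 0 < 1 + mxnorm1 a by rewrite ltr_wpDr.
rewrite mxE normrM normfV (gtr0_norm a1) mulrC ler_pdivrMr// mul1r.
by rewrite (le_trans (entry_le_mxnorm1 a i 0))// lerDr.
Qed.

Lemma mxnorm1_dist a b : `|mxnorm1 a - mxnorm1 b| <= mxnorm1 (a - b).
Proof.
have := mxnorm1_triangle (a - b) b; have := mxnorm1_triangle (b - a) a.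
have -> : mxnorm1 (b - a) = mxnorm1 (a - b).
  by rewrite !mxnorm1_col; apply: eq_bigr => i _; rewrite !mxE distrC.
by rewrite !subrK ler_norml => ? ?; apply/andP; split; lra.
Qed.

Lemma normalize_lipschitz a b i :
  `|normalize a i 0 - normalize b i 0| <= 2 * mxnorm1 (a - b).
Proof.
have a0 := mxnorm1_ge0 a; have b0 := mxnorm1_ge0 b.
have a1 : 0 < 1 + mxnorm1 a by rewrite ltr_wpDr.
have b1 : 0 < 1 + mxnorm1 b by rewrite ltr_wpDr.
have -> : normalize a i 0 - normalize b i 0 =
    (1 + mxnorm1 a)^-1 * ((a - b) i 0 + normalize b i 0 * (mxnorm1 b - mxnorm1 a)).
  rewrite !mxE; field; by rewrite !gt_eqF.
rewrite normrM (@le_trans _ _ (1 * (mxnorm1 (a - b) + mxnorm1 (a - b))))//; last first.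
  by rewrite mul1r mulr2n mulrDl mul1r.
apply: ler_pM => //.
  by rewrite normfV (gtr0_norm a1) invf_le1// lerDl.
rewrite (le_trans (ler_normD _ _))// lerD ?entry_le_mxnorm1//.
rewrite normrM -[leRHS]mul1r ler_pM ?normalize_le1//.
by rewrite distrC mxnorm1_dist.
Qed.

Definition direction_mx a : 'M[R]_d := normalize a *m (normalize a)^T.

Lemma direction_mxE a i j :
  direction_mx a i j = normalize a i 0 * normalize a j 0.
Proof. by rewrite mxE big_ord1; congr (_ * _); rewrite mxE. Qed.

Lemma direction_mx_le1 a i j : `|direction_mx a i j| <= 1.
Proof.
by rewrite direction_mxE normrM -[leRHS]mul1r ler_pM// normalize_le1.
Qed.

Lemma direction_mx_lipschitz a b i j :
  `|direction_mx a i j - direction_mx b i j| <= 4 * mxnorm1 (a - b).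
Proof.
rewrite !direction_mxE.
have -> : normalize a i 0 * normalize a j 0 - normalize b i 0 * normalize b j 0 =
  (normalize a i 0 - normalize b i 0) * normalize a j 0 +
  normalize b i 0 * (normalize a j 0 - normalize b j 0) by ring.
have m0 := mxnorm1_ge0 (a - b).
have -> : 4 * mxnorm1 (a - b) = 2 * mxnorm1 (a - b) * 1 + 1 * (2 * mxnorm1 (a - b)).
  by ring.
rewrite (le_trans (ler_normD _ _))// lerD// normrM ler_pM//;
  by [exact: normalize_lipschitz|exact: normalize_le1].
Qed.

End normalization.

Lemma det_neq0_near {R : realType} {d} (A : 'M[R]_d) : \det A != 0 ->
  exists2 e : R, 0 < e & forall B : 'M[R]_d, (forall i j, `|A i j - B i j| <= e) -> \det B != 0.
Proof.
move=> A0.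
have FA : Filter (nbhs A) by exact: nbhs_filter.
have cadd : continuous (fun z : R * R => z.1 + z.2).
  by move=> z; apply: cvgD; [exact: cvg_fst|exact: cvg_snd].
have cmul : continuous (fun z : R * R => z.1 * z.2).
  by move=> z; apply: cvgM; [exact: cvg_fst|exact: cvg_snd].
have cdet : \det B @[B --> A] --> \det A.
  rewrite /determinant; apply: (@cvg_big R _ _ 0 xpredT cadd _ _ _ _ _ FA) => s _.
  apply: cvgM; first exact: cvg_cst.
  apply: (@cvg_big R _ _ 1 xpredT cmul _ _ _ _ _ FA) => k _.
  exact: coord_continuous.
have : \forall B \near A, \det B != 0.
  apply: (cdet [set x | x != 0]); apply: open_nbhs_nbhs.
  by split; [exact: open_neq|exact: A0].
move=> /nbhs_normP[r /= r0 Hr]; exists (r / 2); first by rewrite divr_gt0.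
move=> B AB; apply: Hr => /=; apply: (@le_lt_trans _ _ (r / 2)); last by lra.
by apply: norm_mx_le => [|i j]; [rewrite divr_ge0// ltW|rewrite !mxE].
Qed.

(** * Convergence in probability and expectations *)

Section in_probability.
Context {R : realType} {dT : measure_display} {T : measurableType dT}.
Variable P : probability T R.

Lemma ae_eventually_not (F : nat -> set T) : (forall n, measurable (F n)) ->
  {ae P, forall w, \forall n \near \oo, ~ F n w} -> P (F n) @[n --> \oo] --> 0%E.
Proof.
move=> mF aeF.
have mU n : measurable (\bigcup_(k >= n) F k) by apply: bigcup_measurable.
have limsup0 : P (lim_sup_set F) = 0%E.
  have [N [mN N0 HN]] := aeF.
  apply/eqP; rewrite eq_le measure_ge0 andbT -N0.
  apply: le_measure; rewrite ?inE//; first exact: bigcapT_measurable.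
  move=> w Fw; apply: HN => -[n _ Hn].
  by have [k /= nk] := Fw n I; exact: Hn.
have U0 : P (\bigcup_(k >= n) F k) @[n --> \oo] --> 0%E.
  rewrite -limsup0; apply: lim_sup_set_cvg => //.
  by rewrite (le_lt_trans (probability_le1 _ _))// ltry.
apply: squeeze_cvge; last exact: U0; last exact: (cvg_cst 0%E).
apply: nearW => n; rewrite measure_ge0 le_measure ?inE//.
by move=> w Fw; exists n => /=.
Qed.

Lemma cvg_probability1 (S : nat -> set T) :
  (\forall n \near \oo, measurable (S n)) ->
  (forall e : R, 0 < e -> exists E : nat -> set T,
    (\forall n \near \oo, measurable (E n) /\ (P (~` E n) <= e%:E)%E) /\
    {ae P, forall w, \forall n \near \oo, E n w -> S n w}) ->
  P (S n) @[n --> \oo] --> 1%E.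
Proof.
move=> mS HE.
suff H e : 0 < e -> \forall n \near \oo, ((1 - e)%:E <= P (S n))%E.
  have fP : \forall n \near \oo, P (S n) \is a fin_num.
    by near=> n; apply: fin_num_measure; near: n.
  apply/fine_cvgP; split => //; apply/cvgrPdist_le => e e0.
  near=> n.
  have fS : P (S n) \is a fin_num by near: n.
  have : ((1 - e)%:E <= P (S n))%E by near: n; exact: H.
  have : (P (S n) <= 1)%E by apply: probability_le1; near: n.
  rewrite -(fineK fS) !lee_fin /= => s1 es; rewrite ger0_norm ?subr_ge0//; lra.
move=> e0.
have e2 : 0 < e / 2 by rewrite divr_gt0.
have [E [[N1 _ HN1] aeE]] := HE _ e2.
have [N2 _ HN2] := mS.
pose N := maxn N1 N2.
have mE n : (N <= n)%N -> measurable (E n).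
  by move=> Nn; have [] := HN1 n (leq_trans (leq_maxl _ _) Nn).
have mSn n : (N <= n)%N -> measurable (S n).
  by move=> Nn; apply: HN2; rewrite /= (leq_trans (leq_maxr _ _) Nn).
pose F n := if (N <= n)%N then E n `&` ~` S n else set0.
have mF n : measurable (F n).
  rewrite /F; case: ifPn => // Nn.
  by apply: measurableI; [exact: mE|apply: measurableC; exact: mSn].
have F0 : P (F n) @[n --> \oo] --> 0%E.
  apply: ae_eventually_not => //; apply: filterS aeE => w; apply: filterS => n ES.
  by rewrite /F; case: ifP => _ => [[Ew nS]|[]]; exact/nS/ES.
have e2' : (0%:E < (e / 2)%:E :> \bar R)%E by rewrite lte_fin.
near=> n.
have Nn : (N <= n)%N by near: n; exact: nbhs_infty_ge.
have Fe : (P (F n) < (e / 2)%:E)%E.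
  by near: n; exact: (F0 _ (open_ereal_lt' e2')).
have Ee : (P (~` E n) <= (e / 2)%:E)%E.
  by have [] := HN1 n (leq_trans (leq_maxl _ _) Nn).
have mCS : measurable (~` S n) by apply: measurableC; exact: mSn.
have : (P (~` S n) <= e%:E)%E.
  apply: (@le_trans _ _ (P (F n `|` ~` E n))).
    apply: le_measure; rewrite ?inE//.
      by apply: measurableU => //; apply: measurableC; exact: mE.
    move=> w nS; have [Ew|] := pselect (E n w); last by right.
    by left; rewrite /F Nn.
  apply: le_trans (measureU2 _ _ _) _ => //; first by apply: measurableC; exact: mE.
  by rewrite [X in (_ <= X%:E)%E](splitr e) EFinD leeD// ltW.
rewrite probability_setC; last exact: mSn.
rewrite -[P (S n)]fineK; last by apply: fin_num_measure; exact: mSn.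
by rewrite -EFinB !lee_fin; lra.
Unshelve. all: by end_near. Qed.

Lemma markov_sum (N : nat -> T -> \bar R) (m : R) (k : nat) (L : R) : 0 < L ->
  (forall t, measurable_fun setT (N t)) -> (forall t w, (0 <= N t w)%E) ->
  (forall t, (\int[P]_w N t w <= m%:E)%E) -> (0 < k)%N ->
  (P (~` [set w | \sum_(1 <= t < k.+1) N t w <= (k%:R * L)%:E]) <= (m / L)%:E)%E.
Proof.
move=> L0 mN N0 Nm k0.
have k0' : 0 < k%:R :> R by rewrite ltr0n.
pose S w := (\sum_(1 <= t < k.+1) N t w)%E.
have mS : measurable_fun setT S by apply: emeasurable_sum.
have S0 w : (0 <= S w)%E by apply: sume_ge0.
have kL : 0 < k%:R * L by rewrite mulr_gt0.
have H := @le_integral_comp_abse _ _ _ P setT measurableT S (k%:R * L) id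
   (@measurable_id _ _ _) (fun _ => id) (fun _ _ _ _ => id) mS kL.
have IS : (\int[P]_w `|S w| <= (k%:R * m)%:E)%E.
  under eq_integral do rewrite gee0_abs//.
  rewrite ge0_integral_sum//; apply: (@le_trans _ _ (\sum_(1 <= t < k.+1) m%:E)%E).
    by apply: lee_sum.
  by rewrite sumEFin sumr_const_nat subSS subn0 mulr_natl.
have mC : measurable (~` [set w | (S w <= (k%:R * L)%:E)%E]).
  apply: measurableC; rewrite -[X in measurable X]setTI.
  by apply: emeasurable_fun_infty_c.
have PC : (P (~` [set w | S w <= (k%:R * L)%:E]) <=
     P (setT `&` [set w | ((k%:R * L)%:E <= `|S w|)]))%E.
  apply: le_measure; rewrite ?inE//.
    by apply: emeasurable_fun_c_infty => //; exact: measurableT_comp.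
  by move=> w /= /negP; rewrite -ltNge => /ltW; rewrite gee0_abs.
apply: (le_trans PC).
have kLi : (0%:E < (k%:R * L)%:E :> \bar R)%E by rewrite lte_fin.
rewrite -(@lee_pmul2l _ (k%:R * L)%:E)//.
apply: (le_trans H); apply: (le_trans IS).
have LN : L != 0 by rewrite gt_eqF.
by rewrite -EFinM lee_fin -mulrA [L * _]mulrC divfK.
Qed.

End in_probability.

Section expectation_mx.
Context {R : realType} {dT : measure_display} {T : measurableType dT}.
Variable P : probability T R.

Lemma qform_sum d (B : 'M[R]_d) (x : 'cV[R]_d) :
  qform B x = \sum_i \sum_j (x i 0 * x j 0) * B i j.
Proof.
rewrite /qform mxE exchange_big; apply: eq_bigr => j _.
by rewrite mxE mulr_suml; apply: eq_bigr => i _; rewrite mxE; ring.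
Qed.

Lemma integrable_sum_EFin (I : Type) (r : seq I) (h : I -> T -> R) :
  (forall i, P.-integrable setT (EFin \o h i)) ->
  P.-integrable setT (EFin \o (fun w => \sum_(i <- r) h i w)).
Proof.
move=> ih; have := integrable_sum measurableT r (P := xpredT) (fun i _ => ih i).
by apply: eq_integrable => // w _; rewrite /= -sumEFin.
Qed.

Lemma Rintegral_sum (I : Type) (r : seq I) (h : I -> T -> R) :
  (forall i, P.-integrable setT (EFin \o h i)) ->
  \int[P]_w (\sum_(i <- r) h i w) = \sum_(i <- r) \int[P]_w h i w.
Proof.
move=> ih; elim: r => [|i r IH].
  rewrite big_nil; under eq_Rintegral do rewrite big_nil.
  by rewrite Rintegral_cst// mul0r.
rewrite big_cons -IH; under eq_Rintegral do rewrite big_cons.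
by rewrite RintegralD//; exact: integrable_sum_EFin.
Qed.

Section qform_integral.
Context {d : nat}.
Variables (A : T -> 'M[R]_d) (x : 'cV[R]_d).
Hypothesis iA : forall i j, P.-integrable setT (fun w => (A w i j)%:E).

Let iAc i j : P.-integrable setT (EFin \o (fun w => (x i 0 * x j 0) * A w i j)).
Proof.
have := integrableZl measurableT (x i 0 * x j 0) (iA i j).
by apply: eq_integrable => // w _; rewrite /= -EFinM.
Qed.

Lemma integrable_qform : P.-integrable setT (fun w => (qform (A w) x)%:E).
Proof.
have := integrable_sum_EFin (index_enum _) (fun i => integrable_sum_EFin (index_enum _) (iAc i)).
by apply: eq_integrable => // w _; rewrite /= qform_sum.
Qed.

Lemma qform_expect_mx : qform (expect_mx P A) x = \int[P]_w qform (A w) x.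
Proof.
under eq_Rintegral do rewrite qform_sum.
rewrite qform_sum Rintegral_sum; last by move=> i; exact: integrable_sum_EFin.
apply: eq_bigr => i _; rewrite Rintegral_sum//.
by apply: eq_bigr => j _; rewrite [expect_mx P A i j]mxE RintegralZl//; exact: iA.
Qed.

End qform_integral.

Lemma integrable_product_sqr (f g : T -> R) :
  measurable_fun setT f -> measurable_fun setT g ->
  P.-integrable setT (fun w => (f w ^+ 2)%:E) ->
  P.-integrable setT (fun w => (g w ^+ 2)%:E) ->
  P.-integrable setT (fun w => (f w * g w)%:E).
Proof.
move=> mf mg if2 ig2.
apply: (@le_integrable _ _ _ _ _ _ _ (EFin \o (fun w => f w ^+ 2 + g w ^+ 2))) => //.
- by apply/measurable_EFinP; exact: measurable_funM.
- move=> w _; rewrite /= lee_fin [leRHS]ger0_norm ?addr_ge0 ?sqr_ge0//.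
  rewrite normrM -(real_normK (num_real (f w))) -(real_normK (num_real (g w))).
  have := sqr_ge0 (`|f w| - `|g w|); have := normr_ge0 (f w); have := normr_ge0 (g w).
  nra.
- have := integrableD measurableT if2 ig2.
  by apply: eq_integrable => // w _; rewrite /= -EFinD.
Qed.

Lemma expect_direction_mx_det d (Z : T -> 'cV[R]_d) :
  (forall i, measurable_fun setT (fun w => Z w i 0)) ->
  (forall i, P.-integrable setT (fun w => (Z w i 0 ^+ 2)%:E)) ->
  posdefmx (expect_mx P (fun w => Z w *m (Z w)^T)) ->
  \det (expect_mx P (fun w => direction_mx (Z w))) != 0.
Proof.
move=> mZ iZ pdG; apply/negP => /det0P[v v0 vG].
have mN : measurable_fun setT (fun w => mxnorm1 (Z w)).
  by apply: measurable_mxnorm1 => i j; rewrite ord1.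
have mnorm i : measurable_fun setT (fun w => normalize (Z w) i 0).
  under eq_fun do rewrite mxE.
  by apply: measurable_funM => //; apply: measurable_invr; exact: measurable_funD.
have iD i j : P.-integrable setT (fun w => (direction_mx (Z w) i j)%:E).
  apply: (@le_integrable _ _ _ _ _ _ _ (cst 1%:E)) => //.
  - apply/measurable_EFinP; under eq_fun do rewrite direction_mxE.
    exact: measurable_funM.
  - by move=> w _ /=; rewrite lee_fin normr1 direction_mx_le1.
  - exact: finite_measure_integrable_cst.
have iG i j : P.-integrable setT (fun w => ((Z w *m (Z w)^T) i j)%:E).
  have E w : (Z w *m (Z w)^T) i j = Z w i 0 * Z w j 0.
    by rewrite mxE big_ord1; congr (_ * _); rewrite mxE.
  by under eq_fun do rewrite E; exact: integrable_product_sqr.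
pose x := v^T.
have q1 w : qform (direction_mx (Z w)) x = ((normalize (Z w))^T *m x) 0 0 ^+ 2.
  have := qform_gram 0 1 (fun=> normalize (Z w)) x.
  by rewrite /gram !big_nat1.
have q2 w : qform (Z w *m (Z w)^T) x = ((Z w)^T *m x) 0 0 ^+ 2.
  by have := qform_gram 0 1 (fun=> Z w) x; rewrite /gram !big_nat1.
have nrm w : ((normalize (Z w))^T *m x) 0 0 = (1 + mxnorm1 (Z w))^-1 * ((Z w)^T *m x) 0 0.
  by rewrite /normalize linearZ /= -scalemxAl mxE.
have x0 : x != 0 by rewrite -(inj_eq (@trmx_inj _ _ _)) trmxK trmx0.
have mZx : measurable_fun setT (fun w => ((Z w)^T *m x) 0 0).
  under eq_fun do rewrite mxE; apply: measurable_sum => i.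
  by under eq_fun do rewrite mxE; exact: measurable_funM.
have mq : measurable_fun setT (fun w => (qform (direction_mx (Z w)) x)%:E).
  apply/measurable_EFinP; under eq_fun do rewrite q1 nrm; apply: measurable_funX.
  by apply: measurable_funM => //; apply: measurable_invr; exact: measurable_funD.
have int0 : (\int[P]_w `|(qform (direction_mx (Z w)) x)%:E| = 0)%E.
  have H : \int[P]_w qform (direction_mx (Z w)) x = 0.
    by rewrite -(qform_expect_mx x iD) /qform trmxK vG mul0mx mxE.
  have E : (\int[P]_w `|(qform (direction_mx (Z w)) x)%:E| =
      \int[P]_w (qform (direction_mx (Z w)) x)%:E)%E.
    by apply: eq_integral => w _; rewrite gee0_abs// lee_fin q1 sqr_ge0.
  have iq : P.-integrable setT (fun w => (qform (direction_mx (Z w)) x)%:E).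
    exact: integrable_qform.
  by rewrite E -[LHS]fineK; [congr EFin|exact: integrable_fin_num].
move/(ae_eq_integral_abs P measurableT mq) : int0 => ae0.
have : qform (expect_mx P (fun w => Z w *m (Z w)^T)) x = 0.
  rewrite (qform_expect_mx x iG) /Rintegral (ae_eq_integral (cst 0%E))//.
  - by rewrite integral0.
  - by apply/measurable_EFinP; under eq_fun do rewrite q2; exact: measurable_funX.
  - apply: filterS ae0 => w /(_ I) /= [] /eqP.
    rewrite q1 nrm sqrf_eq0 mulf_eq0 invr_eq0 gt_eqF ?ltr_wpDr ?mxnorm1_ge0//=.
    by move=> /eqP H _; rewrite q2 H expr0n.
by have := pdG _ x0 => /[swap] H; rewrite -/(qform _ _) H ltxx.
Qed.

End expectation_mx.

Lemma gradient_continuous {R : realType} {d} (Theta : set 'cV[R]_d)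
    (f : 'cV[R]_d -> R) x :
  C1_on Theta f -> Theta x -> {for x, continuous (gradient f)}.
Proof.
move=> [U [oU TU HU]] Tx.
apply: (@cvg_mx_entries R _ (nbhs x) (nbhs_filter x)) => i j.
under eq_fun do rewrite mxE; rewrite mxE.
by have [_] := HU _ (TU _ Tx); exact.
Qed.

Lemma hessian_continuous {R : realType} {d} (Theta : set 'cV[R]_d)
    (f : 'cV[R]_d -> R) x :
  (forall i, C1_on Theta (partial i f)) -> Theta x -> {for x, continuous (hessian f)}.
Proof.
move=> C1f Tx.
apply: (@cvg_mx_entries R _ (nbhs x) (nbhs_filter x)) => i j.
under eq_fun do rewrite mxE; rewrite mxE.
have [U [oU TU HU]] := C1f j.
by have [_] := HU _ (TU _ Tx); exact.
Qed.

Lemma gradient_lipschitz {R : realType} {d} (Theta : set 'cV[R]_d)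
    (f : 'cV[R]_d -> R) x y :
  (forall i, C1_on Theta (partial i f)) ->
  (forall s : R, 0 <= s <= 1 -> Theta (x + s *: (y - x))) ->
  ((mxnorm1 (gradient f y - gradient f x))%:E <=
    (d%:R * `|y - x|)%:E * supnorm Theta (hessian f))%E.
Proof.
move=> C1f seg.
have Tx : Theta x.
  by have := seg 0; rewrite scale0r addr0; apply; rewrite lexx ler01.
have := supnorm_ge0 (hessian f) (ex_intro _ x Tx).
have : forall z, Theta z -> ((mxnorm1 (hessian f z))%:E <= supnorm Theta (hessian f))%E.
  by move=> z; exact: le_supnorm.
case: (supnorm Theta (hessian f)) => [s Hs s0|_ _|_ //].
  rewrite -EFinM lee_fin mxnorm1_col.
  apply: (@le_trans _ _ (\sum_(i < d) `|y - x| * s)); last first.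
    by rewrite sumr_const card_ord -mulrA mulr_natl.
  apply: ler_sum => i _; rewrite !mxE.
  have [U [oU TU HU]] := C1f i.
  have [r r01|r r01] := @mean_value_direction R d (partial i f) x (y - x).
    by have [] := HU _ (TU _ (seg _ r01)).
  have -> : x + (y - x) = y by rewrite addrC subrK.
  move=> ->; set z := _ + _.
  have Tz : Theta z by exact: seg.
  rewrite derive_partial; last by have [] := HU _ (TU _ Tz).
  rewrite (le_trans (ler_norm_sum _ _ _))//.
  have := Hs _ Tz; rewrite lee_fin => Hsz.
  apply: (@le_trans _ _ (\sum_(k < d) `|y - x| * `|hessian f z k i|)).
    by apply: ler_sum => k _; rewrite normrM [hessian f z k i]mxE ler_wpM2r// norm_coord_le.
  rewrite -mulr_sumr ler_wpM2l// (le_trans _ Hsz)//; exact: mxnorm1_col_le.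
have [v0|v0] := eqVneq (d%:R * `|y - x|) 0; last first.
  by rewrite gt0_muley ?leey// lte_fin lt_def v0 mulr_ge0.
rewrite v0 mul0e lee_fin mxnorm1_col.
move/eqP : v0; rewrite mulf_eq0 normr_eq0 subr_eq0 pnatr_eq0 => /orP[/eqP d0|/eqP ->].
  by rewrite big1// => i _; exfalso; move: (ltn_ord i); rewrite [X in (_ < X)%N]d0.
by rewrite big1// => i _; rewrite subrr mxE normr0.
Qed.

Lemma Fmx_cvg {R : realType} {dT : measure_display} {T : measurableType dT}
    (P : probability T R) {d} (Theta : set 'cV[R]_d) (phi : int -> T -> 'cV[R]_d -> R)
    (theta : 'cV[R]_d) (x : nat -> 'cV[R]_d) :
  Theta theta -> (forall w i, C1_on Theta (partial i (phi 0 w))) ->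
  (forall y i j, Theta y -> measurable_fun setT (fun w => hessian (phi 0 w) y i j)) ->
  (\int[P]_w supnorm Theta (hessian (phi (0 : int)%R w)) < +oo)%E ->
  (\forall n \near \oo, Theta (x n)) -> x @ \oo --> theta ->
  Fmx P phi (x n) @[n --> \oo] --> Fmx P phi theta.
Proof.
move=> Tt C1p mH iN nTx xt.
pose y n := if `[< Theta (x n) >] then x n else theta.
have Ty n : Theta (y n) by rewrite /y; case: asboolP.
have xy : \forall n \near \oo, x n = y n.
  by apply: filterS nTx => n Tx; rewrite /y asboolT.
have yt : y @ \oo --> theta by apply: cvg_trans xt; apply: near_eq_cvg; apply: filterS xy => n.
suff : Fmx P phi (y n) @[n --> \oo] --> Fmx P phi theta.
  by apply: cvg_trans; apply: near_eq_cvg; apply: filterS xy => n ->.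
apply: cvg_mx_entries => i j.
have hE z : Fmx P phi z i j = fine (\int[P]_w (hessian (phi (0 : int)%R w) z i j)%:E)%E.
  by rewrite [LHS]mxE.
under eq_fun do rewrite hE; rewrite hE.
have mN : measurable_fun setT (fun w => supnorm Theta (hessian (phi (0 : int)%R w))).
  apply: measurable_supnorm => [||w z Tz]; first by exists theta.
    by move=> z k l Tz; exact: mH.
  exact: hessian_continuous (C1p w) Tz.
have N0 w : (0 <= supnorm Theta (hessian (phi (0 : int)%R w)))%E.
  by apply: supnorm_ge0; exists theta.
have iN' : P.-integrable setT (fun w => supnorm Theta (hessian (phi (0 : int)%R w))).
  by apply/integrableP; split => //; under eq_integral do rewrite gee0_abs//.
have [|||||if_ _ cvgI] := @dominated_convergence _ _ _ P setT measurableT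
  (fun n w => (hessian (phi 0 w) (y n) i j)%:E)
  (fun w => (hessian (phi 0 w) theta i j)%:E)
  (fun w => supnorm Theta (hessian (phi (0 : int)%R w))).
- by move=> n; apply/measurable_EFinP; exact: mH.
- by apply/measurable_EFinP; exact: mH.
- apply: aeW => w _; apply: cvg_EFin; first by near=> n.
  have yh : hessian (phi 0 w) (y n) @[n --> \oo] --> hessian (phi 0 w) theta.
    exact: (cvg_comp y _ yt (hessian_continuous (C1p w) Tt)).
  exact: cvg_entry i j yh.
- exact: iN'.
- apply: aeW => w n _; apply: le_trans (le_supnorm _ (Ty n)).
  by rewrite lee_fin entry_le_mxnorm1.
apply: fine_cvg; rewrite fineK; first exact: cvgI.
exact: integrable_fin_num.
Unshelve. all: by end_near. Qed.

(** * Divergence along one outcome *)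

Section one_sample.
Context {R : realType} {d : nat}.
Variables (Theta : set 'cV[R]_d) (c phi : nat -> 'cV[R]_d -> R).
Variables (theta x : 'cV[R]_d) (u : nat) (L : R).
Hypothesis u2 : (1 < u)%N.

Definition controlled : Prop :=
  [/\ (\sum_(1 <= t < u.+1) supnorm Theta (hessian (phi t)) <= (u%:R * L)%:E)%E,
      (\sum_(1 <= t < u.+1) (mxnorm1 (gradient (phi t) theta))%:E <= (u%:R * L)%:E)%E &
      ((Num.sqrt (u - 1)%N%:R)^-1%:E * \sum_(1 <= t < u.+1)
        supnorm Theta (fun y => (gradient (c t) y - gradient (phi t) y)%R) <= 1%:E)%E].

Lemma sum_gradient_dist :
  controlled -> Theta x ->
  (forall t i, C1_on Theta (partial i (phi t))) ->
  (forall s : R, 0 <= s <= 1 -> Theta (theta + s *: (x - theta))) ->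
  \sum_(1 <= t < u.+1) mxnorm1 (gradient (c t) x - gradient (phi t) theta) <=
    Num.sqrt (u - 1)%N%:R + d%:R * `|x - theta| * (u%:R * L).
Proof.
move=> [HN _ HZ] Tx C1p seg.
have r0 : 0 < Num.sqrt (u - 1)%N%:R :> R by rewrite sqrtr_gt0 ltr0n subn_gt0.
rewrite -lee_fin EFinD -sumEFin.
apply: (@le_trans _ _ (\sum_(1 <= t < u.+1)
    ((mxnorm1 (gradient (c t) x - gradient (phi t) x))%:E +
     (mxnorm1 (gradient (phi t) x - gradient (phi t) theta))%:E))%E).
  apply: lee_sum => t _; rewrite -EFinD lee_fin.
  have -> : gradient (c t) x - gradient (phi t) theta =
    (gradient (c t) x - gradient (phi t) x) + (gradient (phi t) x - gradient (phi t) theta).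
    by rewrite addrA subrK.
  exact: mxnorm1_triangle.
rewrite big_split; apply: leeD.
  apply: (@le_trans _ _ (\sum_(1 <= t < u.+1)
      supnorm Theta (fun y => gradient (c t) y - gradient (phi t) y)%R)%E).
    by apply: lee_sum => t _; exact: (@le_supnorm _ _ _ _ _ (fun y => gradient (c t) y - gradient (phi t) y)).
  by move: HZ; rewrite lee_pdivrMl// mule1.
apply: (@le_trans _ _ (\sum_(1 <= t < u.+1)
    (d%:R * `|x - theta|)%:E * supnorm Theta (hessian (phi t)))%E).
  by apply: lee_sum => t _; exact: gradient_lipschitz.
rewrite -ge0_sume_distrr; last by move=> t _; apply: supnorm_ge0; exists x.
by rewrite [leRHS]EFinM lee_wpmul2l// lee_fin mulr_ge0.
Qed.

Variable eta : R.
Hypothesis close : \sum_(1 <= t < u.+1)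
  mxnorm1 (gradient (c t) x - gradient (phi t) theta) <= u%:R * eta.

Let u0 : 0 < u%:R :> R. Proof. by rewrite ltr0n ltnW. Qed.

Lemma average_direction_mx_dist i j :
  `|(u%:R^-1 *: gram 1 u.+1 (fun t => normalize (gradient (c t) x))) i j -
    (\sum_(1 <= t < u.+1) direction_mx (gradient (phi t) theta) i j) / u%:R| <= 4 * eta.
Proof.
rewrite mxE summxE mulrC -mulrBl normrM normfV (gtr0_norm u0) ler_pdivrMr//.
rewrite -sumrB (le_trans (ler_norm_sum _ _ _))//.
apply: (@le_trans _ _ (\sum_(1 <= t < u.+1)
    4 * mxnorm1 (gradient (c t) x - gradient (phi t) theta))).
  by apply: ler_sum => t _; exact: direction_mx_lipschitz.
by rewrite -mulr_sumr -mulrA ler_wpM2l// mulrC.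
Qed.

Lemma sum_gradient_le :
  (\sum_(1 <= t < u.+1) (mxnorm1 (gradient (phi t) theta))%:E <= (u%:R * L)%:E)%E ->
  \sum_(1 <= t < u.+1) mxnorm1 (gradient (c t) x) <= u%:R * (L + eta).
Proof.
rewrite sumEFin lee_fin mulrDr => HL; rewrite (le_trans _ (lerD HL close))//.
rewrite -big_split /=; apply: ler_sum => t _.
rewrite -[X in mxnorm1 X <= _](subrK (gradient (phi t) theta)) addrC.
by rewrite (le_trans (mxnorm1_triangle _ _))// addrC.
Qed.

End one_sample.

Lemma Ghat_1_gram {R : realType} {d} (c : nat -> 'cV[R]_d -> R) th (u : nat) :
  (0 < u)%N -> Ghat c th 1 u = u%:R^-1 *:
    gram 1 u.+1 (fun t => gradient (c t) (th 1%N u)).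
Proof. by move=> u0; rewrite Ghat_gram subnK. Qed.

Lemma Ghat_unitmx {R : realType} {d} (c : nat -> 'cV[R]_d -> R) th (u : nat) :
  (0 < u)%N ->
  \det (u%:R^-1 *: gram 1 u.+1 (fun t => normalize (gradient (c t) (th 1%N u)))) != 0 ->
  Ghat c th 1 u \in unitmx.
Proof.
move=> u0; rewrite -unitfE -unitmxE Ghat_1_gram//.
have uu : u%:R^-1 \is a (@GRing.unit R).
  by rewrite unitfE invr_eq0 pnatr_eq0 -lt0n.
by rewrite !unitmxZ//; exact: gram_unitmx.
Qed.

Lemma qform_Ghat_le {R : realType} {d} (c : nat -> 'cV[R]_d -> R) th (u : nat) (K : R) y :
  (0 < u)%N ->
  \sum_(1 <= t < u.+1) mxnorm1 (gradient (c t) (th 1%N u)) <= u%:R * K ->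
  qform (Ghat c th 1 u) y <= u%:R * K ^+ 2 * sqnorm y.
Proof.
move=> u0 HK; have u0' : 0 < u%:R :> R by rewrite ltr0n.
rewrite Ghat_1_gram// qformZ mulrC ler_pdivrMr//.
rewrite (le_trans (qform_gram_le _ _ _ _))// [leRHS]mulrAC ler_wpM2r ?sqnorm_ge0//.
have -> : u%:R * K ^+ 2 * u%:R = (u%:R * K) ^+ 2 by ring.
have S0 : 0 <= \sum_(1 <= t < u.+1) mxnorm1 (gradient (c t) (th 1%N u)).
  by apply: sumr_ge0 => t _; exact: mxnorm1_ge0.
by rewrite lerXn2r// nnegrE (le_trans S0).
Qed.

Lemma Fhat_cvg {R : realType} {d} (Theta : set 'cV[R]_d) (c : nat -> nat -> 'cV[R]_d -> R)
    (th : nat -> nat -> nat -> 'cV[R]_d) (u : nat -> nat) (F : 'cV[R]_d -> 'M[R]_d) theta :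
  u n @[n --> \oo] --> \oo ->
  (\forall n \near \oo, Theta (th n 1%N (u n))) ->
  supnorm Theta (fun x => (u n - 1)%N%:R^-1 *:
    (\sum_(1 <= t < (u n).+1) hessian (c n t) x) - F x) @[n --> \oo] --> 0%E ->
  F (th n 1%N (u n)) @[n --> \oo] --> F theta ->
  Fhat (c n) (th n) 1 (u n) @[n --> \oo] --> F theta.
Proof.
move=> uoo Tth sup0 Fth.
pose A n := (u n - 1)%N%:R^-1 *: \sum_(1 <= t < (u n).+1) hessian (c n t) (th n 1%N (u n)).
have AF : A n @[n --> \oo] --> F theta.
  have -> : F theta = 0 + F theta by rewrite add0r.
  have -> : A = (fun n => (A n - F (th n 1%N (u n))) + F (th n 1%N (u n))).
    by apply/funext => n; rewrite subrK.
  apply: cvgD => //; apply/cvgrPdist_le => e e0.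
  have e0' : (0%:E < e%:E :> \bar R)%E by rewrite lte_fin.
  have near_e := sup0 _ (open_ereal_lt' e0').
  near=> n.
  have sn : (supnorm Theta (fun x => (u n - 1)%N%:R^-1 *:
    (\sum_(1 <= t < (u n).+1) hessian (c n t) x) - F x)%R < e%:E)%E.
    by near: n; exact: near_e.
  rewrite sub0r normrN; apply: norm_mx_le (ltW e0) _ => i j.
  apply: le_trans (entry_le_mxnorm1 _ i j) _; rewrite -lee_fin.
  apply: le_trans (ltW sn).
  apply: (@le_supnorm _ _ _ _ Theta (fun x => (u n - 1)%N%:R^-1 *:
    (\sum_(1 <= t < (u n).+1) hessian (c n t) x) - F x)).
  by near: n.
have ratio : (u n - 1)%N%:R / (u n)%:R @[n --> \oo] --> (1 : R).
  apply/cvgrPdist_le => e e0.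
  have [k ke] := exists_natr_gt e^-1.
  near=> n.
  have un : (maxn k 1 <= u n)%N by near: n; exact: (uoo _ (nbhs_infty_ge _)).
  move: un; rewrite geq_max => /andP[ku u1].
  have u0 : 0 < (u n)%:R :> R by rewrite ltr0n.
  have -> : 1 - (u n - 1)%N%:R / (u n)%:R = (u n)%:R^-1 :> R.
    rewrite natrB// -{1}(@divff _ (u n)%:R) ?gt_eqF// -mulrBl.
    by rewrite opprB addrC subrK mul1r.
  rewrite gtr0_norm ?invr_gt0// -[leRHS]invrK lef_pV2 ?posrE ?invr_gt0//.
  by rewrite (le_trans (ltW ke))// ler_nat.
have FA := cvgZ ratio AF; rewrite scale1r in FA.
apply: cvg_trans (FA _); apply: near_eq_cvg; near=> n.
have u1 : (1 < u n)%N by near: n; exact: (uoo _ (nbhs_infty_gt _)).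
rewrite /Fhat /A scalerA subnK ?(ltnW u1)//; congr (_ *: _).
have : (u n - 1)%N%:R != 0 :> R by rewrite pnatr_eq0 -lt0n subn_gt0.
by move=> h; rewrite mulrAC mulfV// mul1r.
Unshelve. all: by end_near. Qed.

Lemma cvg_sum_fin {R : realType} {U : Type} (F : set_system U) {FF : Filter F}
    (I : Type) (r : seq I) (f : I -> U -> R) (l : I -> R) :
  (forall i, f i x @[x --> F] --> l i) ->
  \sum_(i <- r) f i x @[x --> F] --> \sum_(i <- r) l i.
Proof.
move=> fl; have cadd : continuous (fun z : R * R => z.1 + z.2).
  by move=> z; apply: cvgD; [exact: cvg_fst|exact: cvg_snd].
by apply: (@cvg_big R _ _ 0 xpredT cadd _ _ _ _ _ FF) => i _; exact: fl.
Qed.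

Lemma cvg_mulmx_col {R : realType} {d} (A : nat -> 'M[R]_d) (x : nat -> 'cV[R]_d)
    (B : 'M[R]_d) (y : 'cV[R]_d) :
  A @ \oo --> B -> x @ \oo --> y -> A n *m x n @[n --> \oo] --> B *m y.
Proof.
move=> AB xy; apply: cvg_mx_entries => i j; rewrite mxE; under eq_fun do rewrite mxE.
by apply: cvg_sum_fin => k; apply: cvgM; exact: cvg_entry.
Qed.

Lemma sqnorm_cvg_gt {R : realType} {d} (y : nat -> 'cV[R]_d) (l : 'cV[R]_d) :
  y @ \oo --> l -> l != 0 ->
  exists2 k : R, 0 < k & \forall n \near \oo, k <= sqnorm (y n).
Proof.
move=> yl l0.
have sl : sqnorm (y n) @[n --> \oo] --> sqnorm l.
  rewrite sqnormE; under eq_fun do rewrite sqnormE.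
  by apply: cvg_sum_fin => i; under eq_fun do rewrite expr2; rewrite expr2;
    apply: cvgM; exact: cvg_entry.
have l1 := sqnorm_gt0 l0.
exists (sqnorm l / 2); first by rewrite divr_gt0.
by apply: (cvgr_ge _ sl); lra.
Qed.

Lemma near_change_point {R : realType} (tau : R) (ts v : nat -> nat) :
  0 < tau < 1 -> (forall n, ts n = Num.truncn (n%:R * tau)) ->
  (v n)%:R / n%:R @[n --> \oo] --> (0 : R) ->
  \forall n \near \oo, [/\ (0 < n)%N, n%:R * (tau / 2) <= (ts n)%:R,
    (ts n)%:R <= n%:R * ((1 + tau) / 2), (v n <= ts n)%N & (ts n + v n <= n)%N].
Proof.
move=> /andP[t0 t1] tsE v0.
have tm : 0 < Num.min (tau / 2) ((1 - tau) / 2).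
  by rewrite lt_min !divr_gt0// subr_gt0.
have [k kt] := exists_natr_gt (2 / tau).
near=> n.
have n0 : (0 < n)%N by near: n; exact: nbhs_infty_gt.
have n0' : 0 < n%:R :> R by rewrite ltr0n.
have kn : (k <= n)%N by near: n; exact: nbhs_infty_ge.
have nt : 0 <= n%:R * tau by rewrite mulr_ge0// ltW.
have /andP[ts_le ts_gt] := truncn_itv nt.
rewrite -tsE -natr1 in ts_le ts_gt.
have n2 : 2 <= n%:R * tau.
  rewrite -ler_pdivrMr// (le_trans (ltW kt))// ler_nat//.
have vn : `|0 - (v n)%:R / n%:R| <= Num.min (tau / 2) ((1 - tau) / 2).
  by near: n; move/cvgrPdist_le : v0; exact.
rewrite sub0r normrN ger0_norm ?divr_ge0// ler_pdivrMr// in vn.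
have v1 : (v n)%:R <= tau / 2 * n%:R.
  by rewrite (le_trans vn)// ler_wpM2r// ge_min lexx.
have v2 : (v n)%:R <= (1 - tau) / 2 * n%:R.
  by rewrite (le_trans vn)// ler_wpM2r// ge_min lexx orbT.
have H1 : n%:R * (tau / 2) <= (ts n)%:R.
  by move: n2 ts_gt; rewrite mulrA; lra.
have H2 : (ts n)%:R <= n%:R * ((1 + tau) / 2).
  rewrite (le_trans ts_le)// ler_wpM2l// ; lra.
split => //.
  by rewrite -(ler_nat R) (le_trans v1)// mulrC.
rewrite -(ler_nat R) natrD (le_trans (lerD H2 v2))//.
by move: (n%:R : R) => a; lra.
Unshelve. all: by end_near. Qed.

Lemma Qhat_at_ge {R : realType} {d} (c : nat -> 'cV[R]_d -> R) th (n u k : nat)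
    (tau q : R) :
  (0 < n)%N -> n%:R * (tau / 2) <= k%:R -> k%:R <= n%:R * ((1 + tau) / 2) ->
  0 < tau < 1 -> 0 <= q ->
  q <= qform (Omegahat c th n u) (th 1%N k - th k.+1 n) ->
  n%:R * (tau / 2 * ((1 - tau) / 2)) ^+ 2 * q <= Qhat_at c th n u k.
Proof.
move=> n0 k1 k2 /andP[t0 t1] q0 qO.
have n0' : 0 < n%:R :> R by rewrite ltr0n.
rewrite /Qhat_at -/(qform _ _).
have kn : (k <= n)%N.
  by rewrite -(ler_nat R) (le_trans k2)// ler_piMr//; lra.
have r0 : 0 <= (tau / 2 * ((1 - tau) / 2)) by rewrite !mulr_ge0//; lra.
have pre : n%:R * (tau / 2 * ((1 - tau) / 2)) ^+ 2 <= (k * (n - k))%N%:R ^+ 2 / n%:R ^+ 3 :> R.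
  rewrite ler_pdivlMr ?exprn_gt0//.
  have -> : n%:R * (tau / 2 * ((1 - tau) / 2)) ^+ 2 * n%:R ^+ 3 =
     (n%:R * (tau / 2) * (n%:R * ((1 - tau) / 2))) ^+ 2 by ring.
  rewrite lerXn2r ?nnegrE ?mulr_ge0//; [lra|lra|].
  rewrite natrM natrB//; apply: ler_pM => //; rewrite ?mulr_ge0//; try lra.
apply: ler_pM => //; rewrite mulr_ge0 ?exprn_ge0//.
Qed.

Section divergence.
Context {R : realType} {d : nat}.
Variables (Theta : set 'cV[R]_d) (c : nat -> nat -> 'cV[R]_d -> R).
Variables (phi : nat -> 'cV[R]_d -> R) (th : nat -> nat -> nat -> 'cV[R]_d).
Variables (theta1 theta2 : 'cV[R]_d) (u v ts : nat -> nat) (tau : R).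
Variables (F G : 'M[R]_d).
Hypothesis tau01 : 0 < tau < 1.
Hypothesis tsE : forall n, ts n = Num.truncn (n%:R * tau).
Hypothesis u_oo : u n @[n --> \oo] --> \oo.
Hypothesis u_o : (u n)%:R / n%:R @[n --> \oo] --> (0 : R).
Hypothesis v_o : (v n)%:R / n%:R @[n --> \oo] --> (0 : R).
Hypothesis c2 : \forall n \near \oo, forall t, (1 <= t <= n)%N -> C2_on Theta (c n t).
Hypothesis thT : \forall n \near \oo,
  Theta (th n 1%N (u n)) /\ Theta (th n (u n).+1 n).
Hypothesis th_u : th n 1%N (u n) @[n --> \oo] --> theta1.
Hypothesis th_1 : th n 1%N (ts n) @[n --> \oo] --> theta1.
Hypothesis th_2 : th n (ts n).+1 n @[n --> \oo] --> theta2.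
Hypothesis theta1_int : interior Theta theta1.
Hypothesis theta12 : theta1 <> theta2.
Hypothesis phi_C1 : forall t i, C1_on Theta (partial i (phi t)).
Hypothesis Fcvg : Fhat (c n) (th n) 1 (u n) @[n --> \oo] --> F.
Hypothesis Funit : F \in unitmx.
Hypothesis Gcvg : forall i j,
  (\sum_(1 <= t < n.+1) direction_mx (gradient (phi t) theta1) i j) / n%:R
    @[n --> \oo] --> G i j.
Hypothesis Gdet : \det G != 0.

Lemma Qhat_eventually_gt (L M : R) : 0 < L ->
  \forall n \near \oo, controlled Theta (c n) phi theta1 (u n) L ->
    (M%:E < Qhat (c n) (th n) n (u n) (v n))%E.
Proof.
move=> L0.
have [e e0 He] := det_neq0_near Gdet.
pose eta := Num.min 1 (e / 8).
have eta0 : 0 < eta by rewrite lt_min ltr01 divr_gt0.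
have eta1 : eta <= 1 by rewrite ge_min lexx.
have etae : 4 * eta <= e / 2.
  have : eta <= e / 8 by rewrite ge_min lexx orbT.
  lra.
have [k k0 Hk] : exists2 k : R, 0 < k & \forall n \near \oo,
    k <= sqnorm (Fhat (c n) (th n) 1 (u n) *m (th n 1%N (ts n) - th n (ts n).+1 n)).
  apply: (@sqnorm_cvg_gt R d _ (F *m (theta1 - theta2))).
    by apply: cvg_mulmx_col => //; exact: cvgB.
  apply/negP => /eqP F0; apply: theta12; apply/eqP; rewrite -subr_eq0.
  by rewrite -[X in X == 0]mul1mx -(mulVmx Funit) -mulmxA F0 mulmx0.
have [r /= r0 Hr] : exists2 r : R, 0 < r & forall z, `|theta1 - z| < r -> Theta z.
  by have /nbhs_normP[r r0 Hr] := theta1_int; exists r.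
pose K := L + 1.
have K0 : 0 < K by rewrite addr_gt0.
pose q := (tau / 2 * ((1 - tau) / 2)) ^+ 2.
have q0 : 0 < q.
  by move/andP: tau01 => [? ?]; rewrite exprn_gt0// mulr_gt0// divr_gt0// subr_gt0.
pose C := q * (k / (2 * K ^+ 2)).
have C0 : 0 < C by rewrite mulr_gt0// divr_gt0// mulr_gt0// exprn_gt0.
have M0 : 0 < `|M| + 1 by rewrite ltr_wpDl.
have CM : 0 < C / (`|M| + 1) by rewrite divr_gt0.
have xL : 0 < eta / (2 * (d%:R + 1) * L).
  by rewrite divr_gt0// !mulr_gt0// ltr_wpDl.
have [k2 Hk2] := exists_natr_gt ((eta / 2) ^- 2).
have near_G : \forall n \near \oo, forall i j, `|G i j - (\sum_(1 <= t < (u n).+1)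
    direction_mx (gradient (phi t) theta1) i j) / (u n)%:R| <= e / 2.
  apply: filter_forall => i; apply: filter_forall => j.
  have := cvg_comp u _ u_oo (@Gcvg i j) => /cvgrPdist_le; apply.
  by rewrite divr_gt0.
have near_u : \forall n \near \oo, (u n <= n)%N.
  have := u_o => /cvgrPdist_lt /(_ _ ltr01); apply: filterS2; last exact: (nbhs_infty_gt 0).
  move=> n n0; rewrite sub0r normrN ger0_norm ?divr_ge0// ltr_pdivrMr ?ltr0n// mul1r.
  by rewrite ltr_nat => /ltnW.
near=> n => ctrl.
have u2 : (maxn k2 2 <= u n)%N.
  by near: n; exact: (u_oo (nbhs_infty_ge (maxn k2 2))).
move: u2; rewrite geq_max => /andP[k2u u2].
have u0 : (0 < u n)%N by rewrite ltnW.
have u0' : 0 < (u n)%:R :> R by rewrite ltr0n.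
have [n0 ts1 ts2 vts tsv] : [/\ (0 < n)%N, n%:R * (tau / 2) <= (ts n)%:R,
    (ts n)%:R <= n%:R * ((1 + tau) / 2), (v n <= ts n)%N & (ts n + v n <= n)%N].
  by near: n; exact: near_change_point.
have n0' : 0 < n%:R :> R by rewrite ltr0n.
have [Tu Tu'] : Theta (th n 1%N (u n)) /\ Theta (th n (u n).+1 n) by near: n.
have xr : `|theta1 - th n 1%N (u n)| < r.
  by near: n; move/cvgrPdist_lt : th_u; exact.
have xe : `|theta1 - th n 1%N (u n)| <= eta / (2 * (d%:R + 1) * L).
  by near: n; move/cvgrPdist_le : th_u; exact.
have un : `|0 - (u n)%:R / n%:R| < C / (`|M| + 1).
  by near: n; move/cvgrPdist_lt : u_o; exact.
rewrite sub0r normrN ger0_norm ?divr_ge0// in un.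
have Gn : forall i j, `|G i j - (\sum_(1 <= t < (u n).+1)
    direction_mx (gradient (phi t) theta1) i j) / (u n)%:R| <= e / 2 by near: n.
have c2n : forall t, (1 <= t <= n)%N -> C2_on Theta (c n t) by near: n.
have kn : k <= sqnorm (Fhat (c n) (th n) 1 (u n) *m
    (th n 1%N (ts n) - th n (ts n).+1 n)) by near: n.
have unn : (u n <= n)%N by near: n.
set x := th n 1%N (u n) in Tu xr xe kn *.
have seg (s : R) : 0 <= s <= 1 -> Theta (theta1 + s *: (x - theta1)).
  move=> /andP[s0 s1]; apply: Hr; rewrite opprD addrA subrr sub0r normrN normrZ.
  by rewrite ger0_norm// distrC (le_lt_trans _ xr)// ler_piMl.
have close : \sum_(1 <= t < (u n).+1)
    mxnorm1 (gradient (c n t) x - gradient (phi t) theta1) <= (u n)%:R * eta.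
  apply: le_trans (sum_gradient_dist u2 ctrl Tu phi_C1 seg) _.
  have sq : Num.sqrt (u n - 1)%N%:R <= eta / 2 * (u n)%:R.
    have h0 : 0 < eta / 2 by rewrite divr_gt0.
    have eu : 0 <= eta / 2 * (u n)%:R by rewrite mulr_ge0// ltW.
    rewrite -[leRHS]ger0_norm// -sqrtr_sqr ler_sqrt ?sqr_ge0//.
    apply: (@le_trans _ _ (u n)%:R); first by rewrite ler_nat leq_subr.
    rewrite exprMn [X in _ * X]expr2 mulrA ler_peMl// -ler_pdivrMl ?exprn_gt0//.
    by rewrite mulr1 (le_trans (ltW Hk2))// ler_nat.
  have d1 : 0 < d%:R + 1 :> R by rewrite ltr_wpDl.
  have dx : d%:R * `|x - theta1| * ((u n)%:R * L) <= eta / 2 * (u n)%:R.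
    rewrite distrC mulrA mulrAC ler_wpM2r//.
    apply: (@le_trans _ _ ((d%:R + 1) * (eta / (2 * (d%:R + 1) * L)) * L)).
      by rewrite ler_wpM2r ?(ltW L0)// ler_pM// lerDl.
    have -> : (d%:R + 1) * (eta / (2 * (d%:R + 1) * L)) * L = eta / 2; last by [].
    by field; rewrite !gt_eqF.
  rewrite (le_trans (lerD sq dx))// -mulrDl -splitr mulrC //.
have [_ ctrl2 _] := ctrl.
have Gu : Ghat (c n) (th n) 1 (u n) \in unitmx.
  apply: Ghat_unitmx => //; apply: He => i j.
  have := average_direction_mx_dist u2 close i j; rewrite -/x.
  move: (_ *: _) => X; move: (Gn i j); set Y := _ / _ => H1 H2.
  have -> : G i j - X i j = (G i j - Y) - (X i j - Y) by rewrite opprB addrA subrK.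
  rewrite (le_trans (ler_normB _ _))// (splitr e) lerD//.
  exact: le_trans H2 etae.
have Gb y : qform (Ghat (c n) (th n) 1 (u n)) y <= (u n)%:R * K ^+ 2 * sqnorm y.
  apply: qform_Ghat_le => //; apply: le_trans (sum_gradient_le close ctrl2) _.
  by rewrite ler_wpM2l// lerD2l.
have b0 : 0 < (u n)%:R * K ^+ 2 by rewrite mulr_gt0// exprn_gt0.
have Om : k / (2 * ((u n)%:R * K ^+ 2)) <=
    qform (Omegahat (c n) (th n) n (u n)) (th n 1%N (ts n) - th n (ts n).+1 n).
  apply: le_trans (qform_Omegahat_ge _ _ _ Gu b0 Gb).
  - by rewrite ler_wpM2r// invr_ge0 mulr_ge0// ltW.
  - move=> t /andP[t1 tu]; apply: C2_on_sub (c2n t _).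
      by move=> _ ->.
    by rewrite t1 (leq_trans tu).
  - move=> t /andP[ut tn]; apply: C2_on_sub (c2n t _).
      by move=> _ ->.
    by rewrite tn (leq_ltn_trans _ ut).
have Q := Qhat_at_ge n0 ts1 ts2 tau01 _ Om.
apply: (@lt_le_trans _ _ (Qhat_at (c n) (th n) n (u n) (ts n))%:E); last first.
  apply: le_bigmax_seq; last by rewrite vts tsv.
  by rewrite mem_index_iota /= ltnS (leq_trans (leq_addr _ _) tsv).
rewrite lte_fin; apply: lt_le_trans (Q _); last first.
  by rewrite divr_ge0 ?(ltW k0)// mulr_ge0// ltW.
apply: (@lt_trans _ _ (`|M| + 1)); first by rewrite (le_lt_trans (ler_norm M))// ltrDl.
have -> : n%:R * (tau / 2 * ((1 - tau) / 2)) ^+ 2 * (k / (2 * ((u n)%:R * K ^+ 2))) =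
    C * (n%:R / (u n)%:R).
  by rewrite /C -/q; field; rewrite !gt_eqF.
move: un; rewrite ltr_pdivrMr// => un.
rewrite mulrA ltr_pdivlMr//.
have := un; rewrite mulrAC ltr_pdivlMr// mulrC.
by rewrite mulrC.
Unshelve. all: by end_near. Qed.

End divergence.

(** * Measurability of the statistic and moments *)

Section measurable_statistic.
Context {R : realType} {dT : measure_display} {T : measurableType dT} {d : nat}.
Variables (Theta : set 'cV[R]_d) (c : T -> nat -> 'cV[R]_d -> R).
Variables (th : nat -> nat -> T -> 'cV[R]_d) (n : nat).
Hypothesis mth : forall l l' i, measurable_fun setT (fun w => th l l' w i 0).
Hypothesis mc : forall t x, (1 <= t <= n)%N -> measurable_fun setT (fun w => c w t x).
Hypothesis c2 : forall t w, (1 <= t <= n)%N -> C2_on Theta (c w t).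

Lemma measurable_Ghat l l' : (1 <= l)%N -> (l' <= n)%N ->
  (forall w, Theta (th l l' w)) ->
  measurable_mx (fun w => Ghat (c w) (fun l l' => th l l' w) l l').
Proof.
move=> l1 ln Tth; apply: measurable_mxZ; apply: measurable_mx_sum => t /andP[lt tl].
have tn : (1 <= t <= n)%N by rewrite (leq_trans l1 lt) (leq_trans _ ln).
have mg : measurable_mx (fun w => gradient (c w t) (th l l' w)).
  move=> i j; under eq_fun do rewrite mxE.
  apply: measurable_partial_at => [k|x|w]; [exact: mth|exact: mc|].
  by have [c1 _] := c2 w tn; apply: C1_on_sub c1 => _ ->.
by apply: measurable_mxM => //; exact: measurable_mx_tr.
Qed.

Lemma measurable_Fhat l l' : (1 <= l)%N -> (l' <= n)%N ->
  (forall w, Theta (th l l' w)) ->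
  measurable_mx (fun w => Fhat (c w) (fun l l' => th l l' w) l l').
Proof.
move=> l1 ln Tth; apply: measurable_mxZ; apply: measurable_mx_sum => t /andP[lt tl].
have tn : (1 <= t <= n)%N by rewrite (leq_trans l1 lt) (leq_trans _ ln).
move=> i j; apply: measurable_hessian_at => [k|x|w]; [exact: mth|exact: mc|].
by apply: C2_on_sub (c2 w tn) => _ ->.
Qed.

Lemma measurable_Qhat u v : (u <= n)%N ->
  (forall w, Theta (th 1%N u w)) -> (forall w, Theta (th u.+1 n w)) ->
  measurable_fun setT (fun w => Qhat (c w) (fun l l' => th l l' w) n u v).
Proof.
move=> un T1 T2; rewrite /Qhat.
have mO : measurable_mx (fun w => Omegahat (c w) (fun l l' => th l l' w) n u).
  apply: measurable_mxZ; apply: measurable_mxD.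
    have mF := measurable_Fhat (leqnn 1) un T1.
    apply: (measurable_mxM _ mF); apply: (measurable_mxM mF).
    by apply: measurable_invmx; exact: measurable_Ghat.
  have mF := @measurable_Fhat u.+1 n isT (leqnn n) T2.
  apply: (measurable_mxM _ mF); apply: (measurable_mxM mF).
  by apply: measurable_invmx; exact: measurable_Ghat.
elim: (index_iota _ _) => [|k s IH].
  by under eq_fun do rewrite big_nil; exact: measurable_cst.
under eq_fun do rewrite big_cons; case: (_ && _) => //.
apply: measurable_maxe => //; apply/measurable_EFinP.
apply: measurable_funM => //.
have mD : measurable_mx (fun w => th 1%N k w - th k.+1 n w).
  by apply: measurable_mxB => i j; rewrite ord1; exact: mth.
by apply: measurable_mxM => //; apply: measurable_mxM => //; exact: measurable_mx_tr.
Qed.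

End measurable_statistic.

Lemma measurable_history {R : realType} {dT : measure_display} {T : measurableType dT}
    (m t : nat) (Y : nat -> T -> m.-tuple R) :
  (forall s i, (1 <= s <= t)%N -> measurable_fun setT (fun w => tnth (Y s w) i)) ->
  measurable_fun setT (fun w => history (fun s => Y s w) t).
Proof.
move=> mY; apply/measurable_fun_tnthP => i; apply/measurable_fun_tnthP => k.
rewrite (_ : _ \o _ = fun w => tnth (Y i.+1 w) k).
  by apply: mY; rewrite /= ltn_ord.
by apply/funext => w /=; rewrite tnth_mktuple.
Qed.

Section moments.
Context {R : realType} {dT : measure_display} {T : measurableType dT}.
Variable P : probability T R.
Context {d : nat}.
Variables (Theta : set 'cV[R]_d) (phi : int -> T -> 'cV[R]_d -> R).

Let H := fun t w (x : Theta * 'I_d * 'I_d) =>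
  hessian (phi t w) (set_val x.1.1) x.1.2 x.2.

Lemma measurable_hessian_phi t x i j : stationary P H -> Theta x ->
  measurable_fun setT (fun w => hessian (phi t w) x i j).
Proof. by move=> [mH _] Tx; exact: (mH t (exist _ x (mem_set Tx), i, j)). Qed.

Lemma stationary_supnorm_hessian (t : nat) : Theta !=set0 -> stationary P H ->
  (forall t w i, C1_on Theta (partial i (phi t w))) ->
  (\int[P]_w supnorm Theta (hessian (phi t%:Z w)) =
   \int[P]_w supnorm Theta (hessian (phi (0 : int)%R w)))%E.
Proof.
move=> T0 statH C1p; have [D TD dD] := countable_dense_sequence T0.
pose pt k : Theta := exist _ (D k) (mem_set (TD k)).
pose f (y : Theta * 'I_d * 'I_d -> R) : \bar R :=
  ereal_sup (range (fun k => (mxnorm1 (\matrix_(i < d, j < d)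
    y (pt k, i, j)))%:E)).
have fE s w : supnorm Theta (hessian (phi s w)) = f (H s w).
  rewrite (supnorm_dense TD dD); last by move=> x; exact: hessian_continuous (C1p s w).
  rewrite /f; set a := (X in ereal_sup (range X) = _).
  set b := (X in _ = ereal_sup (range X)).
  suff -> : a = b by []; apply/funext => k; rewrite /a /b.
  suff -> : hessian (phi s w) (D k) =
    \matrix_(i, j) H s w (pt k, i, j) by [].
  by apply/matrixP => i j; rewrite [RHS]mxE.
have E s : (\int[P]_w supnorm Theta (hessian (phi s w)) = \int[P]_w f (H s w))%E.
  by apply: eq_integral => w _; exact: fE.
rewrite [LHS]E [RHS]E; apply: stationary_integral => //.
  apply: measurable_ereal_sup_range => k; apply/measurable_EFinP.
  apply: measurable_mxnorm1 => i j.
  have := @measurable_coordinate R (Theta * 'I_d * 'I_d)%type 0 (pt k, i, j).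
  by apply: eq_measurable_fun => x _; rewrite mxE.
move=> y; apply: (@le_trans _ _ (mxnorm1 (\matrix_(i < d, j < d)
    y (pt 0%N, i, j)))%:E).
  by rewrite lee_fin mxnorm1_ge0.
by apply: ereal_sup_ubound; exists 0%N.
Qed.

Variable theta : 'cV[R]_d.
Let X := fun t w => gradient (phi t w) theta.

Lemma stationary_mxnorm1_gradient (t : nat) : stationary P (coords X) ->
  (\int[P]_w (mxnorm1 (X t%:Z w))%:E = \int[P]_w (mxnorm1 (X (0 : int)%R w))%:E)%E.
Proof.
move=> statX; pose f (y : 'I_d -> R) : \bar R := (\sum_i `|y i|)%:E.
have fE s w : (mxnorm1 (X s w))%:E = f (coords X s w) by rewrite mxnorm1_col.
have E s : (\int[P]_w (mxnorm1 (X s w))%:E = \int[P]_w f (coords X s w))%E.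
  by apply: eq_integral => w _; exact: fE.
rewrite [LHS]E [RHS]E; apply: stationary_integral => //.
  apply/measurable_EFinP; apply: measurable_sum => i; apply: measurableT_comp => //.
  exact: measurable_coordinate.
by move=> y; rewrite lee_fin sumr_ge0.
Qed.

Lemma ergodic_direction_mx i j : stationary P (coords X) -> ergodic P (coords X) ->
  {ae P, forall w, (\sum_(1 <= t < n.+1) direction_mx (X t%:Z w) i j) / n%:R
    @[n --> \oo] --> expect_mx P (fun w => direction_mx (X 0 w)) i j}.
Proof.
move=> statX ergX; rewrite mxE.
pose g (y : 'I_d -> R) := direction_mx (\col_k y k) i j.
have gE s w : direction_mx (X s w) i j = g (coords X s w).
  rewrite /g; congr (direction_mx _ i j); apply/matrixP => k l.
  by rewrite ord1 [RHS]mxE.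
have := @ergodic_average _ _ _ _ P (coords X) statX g 1 ergX.
under [in X in _ -> X]eq_Rintegral do rewrite gE.
have mg : measurable_fun setT (fun x : path_space R 'I_d => g (x 0)).
  have mcol k l : measurable_fun setT (fun x : path_space R 'I_d => (\col_k x 0 k : 'cV[R]_d) k l).
    have := @measurable_coordinate R 'I_d 0 k.
    by apply: eq_measurable_fun => x _; rewrite mxE.
  have mnorm k : measurable_fun setT
      (fun x : path_space R 'I_d => normalize (\col_k x 0 k : 'cV[R]_d) k 0).
    have : measurable_fun setT (fun x : path_space R 'I_d =>
        (1 + mxnorm1 (\col_k x 0 k : 'cV[R]_d))^-1 * (\col_k x 0 k : 'cV[R]_d) k 0).
      apply: measurable_funM => //; apply: measurable_invr; apply: measurable_funD => //.
      exact: measurable_mxnorm1.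
    by apply: eq_measurable_fun => x _; rewrite [RHS]mxE.
  have := measurable_funM (mnorm i) (mnorm j).
  by apply: eq_measurable_fun => x _; rewrite /g direction_mxE.
move=> /(_ mg (fun y => direction_mx_le1 _ _ _)); apply: filterS => w.
by under [in X in _ -> X]eq_fun do under eq_bigr do rewrite gE.
Qed.

End moments.

Theorem theorem2p2 (R : realType) (dT : measure_display)
    (T : measurableType dT) (P : probability T R) (d m : nat)
    (Theta : set 'cV[R]_d) (hTheta : compact Theta)
    (phihat : forall t : nat, t.-tuple (m.-tuple R) -> 'cV[R]_d -> R)
    (hphihat : forall t x,
       measurable_fun [set: t.-tuple (m.-tuple R)] (fun y => phihat t y x))
    (* the sample of size n is Y n 1, ..., Y n n *)
    (Y : nat -> nat -> T -> m.-tuple R)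
    (thetahat : nat -> nat -> nat -> T -> 'cV[R]_d)
    (hthetahat_meas : forall n l l' i,
       measurable_fun setT (fun w => thetahat n l l' w i 0))
    (hthetahat : forall n l l' w, (1 <= l <= l')%N -> (l' <= n)%N ->
       is_MCE Theta (sample_contrasts phihat Y n w) l l'
         (thetahat n l l' w))
    (u v : nat -> nat)
    (hu : u n @[n --> \oo] --> \oo)
    (hv : v n @[n --> \oo] --> \oo)
    (hun : (u n)%:R / n%:R @[n --> \oo] --> (0 : R))
    (hvn : (v n)%:R / n%:R @[n --> \oo] --> (0 : R))
    (Y1 Y2 : int -> T -> m.-tuple R) (theta1 theta2 : 'cV[R]_d)
    (htheta : theta1 <> theta2)
    (tstar : nat -> nat)
    (hH1 : \forall n \near \oo, change_at (Y n) Y1 Y2 n (tstar n))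
    (hint1 : interior Theta theta1) (hint2 : interior Theta theta2)
    (hA1 : conditionsA P Theta (sample_contrasts phihat Y) thetahat
       (fun=> 1%N) tstar Y1 theta1)
    (hA2 : conditionsA P Theta (sample_contrasts phihat Y) thetahat
       (fun n => (tstar n).+1) id Y2 theta2)
    (hB : exists2 tau : R, 0 < tau < 1 &
       forall n, tstar n = Num.truncn (n%:R * tau)) :
  cvg_pinfty_in_probability P (fun n w =>
    Qhat (sample_contrasts phihat Y n w)
         (fun l l' => thetahat n l l' w) n (u n) (v n)).


Proof.
have [tau tau01 tsE] := hB.
have [tau0 tau1] := andP tau01.
have near_cp := near_change_point tau01 tsE hvn.
have Theta0 : Theta !=set0.
  by exists theta1; exact: interior_subset hint1.
have Theta1 : Theta theta1 by exact: interior_subset hint1.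
pose c n w t := sample_contrasts phihat Y n w t.
have ts_oo : tstar n @[n --> \oo] --> \oo.
  apply/cvgnyPge => N; have [k kN] := exists_natr_gt (N%:R / (tau / 2)).
  near=> n; rewrite -(ler_nat R).
  have [_ + _ _ _] : [/\ (0 < n)%N, n%:R * (tau / 2) <= (tstar n)%:R,
    (tstar n)%:R <= n%:R * ((1 + tau) / 2), (v n <= tstar n)%N & (tstar n + v n <= n)%N].
    by near: n; exact: near_cp.
  apply: le_trans; rewrite -ler_pdivrMr ?divr_gt0// (le_trans (ltW kN))// ler_nat.
  by near: n; exact: nbhs_infty_ge.
have subn1_oo (k : nat -> nat) : k n @[n --> \oo] --> \oo -> (k n - 1)%N @[n --> \oo] --> \oo.
  move=> /cvgnyPge koo; apply/cvgnyPge => N; apply: filterS (koo N.+1) => n Nk.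
  by rewrite leq_subRL ?add1n// (leq_trans _ Nk).
have near_u : \forall n \near \oo, (u n <= tstar n)%N.
  have t2 : 0 < tau / 2 by rewrite divr_gt0.
  near=> n.
  have [n0 + _ _ _] : [/\ (0 < n)%N, n%:R * (tau / 2) <= (tstar n)%:R,
    (tstar n)%:R <= n%:R * ((1 + tau) / 2), (v n <= tstar n)%N & (tstar n + v n <= n)%N].
    by near: n; exact: near_cp.
  have un : `|0 - (u n)%:R / n%:R| <= tau / 2.
    by near: n; move/cvgrPdist_le : hun; exact.
  rewrite sub0r normrN ger0_norm ?divr_ge0// ler_pdivrMr ?ltr0n// mulrC in un.
  by move=> /(le_trans un); rewrite ler_nat.
have near_u1 : \forall n \near \oo, (1 < u n)%N.
  by move/cvgnyPge : hu => /(_ 2%N).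
have near_ts : \forall n \near \oo, (1 < tstar n < n)%N.
  apply: filterS hH1 => n [/andP[t2 tn] _]; rewrite t2 /=.
  have n0 : (0 < n)%N by case: (posnP n) t2 tn => // ->; rewrite leqn0 => + /eqP E; rewrite E.
  by rewrite (leq_ltn_trans tn)// ltn_predL.
have seg_u : segments (fun=> 1%N) tstar (fun=> 1%N) u.
  split => //; last exact: subn1_oo.
  by apply: filterS2 near_u near_u1 => n -> /ltnW ->.
have seg_1 : segments (fun=> 1%N) tstar (fun=> 1%N) tstar.
  split => //; last exact: subn1_oo.
  by apply: filterS near_ts => n /andP[/ltnW -> _]; rewrite !leqnn.
have seg_2 : segments (fun n => (tstar n).+1) id (fun n => (tstar n).+1) id.
  split => //.
    by apply: filterS near_ts => n /andP[_ tn]; rewrite !leqnn tn.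
  apply/cvgnyPge => N; have t2 : 0 < (1 - tau) / 2 by rewrite divr_gt0 ?subr_gt0.
  have [k kN] := exists_natr_gt (N.+1%:R / ((1 - tau) / 2)).
  near=> n; rewrite leq_subRL; last first.
    by have /andP[] : (1 < tstar n < n)%N by near: n.
  rewrite addSnnS -(ler_nat R) natrD.
  have [_ _ ts2 _ _] : [/\ (0 < n)%N, n%:R * (tau / 2) <= (tstar n)%:R,
    (tstar n)%:R <= n%:R * ((1 + tau) / 2), (v n <= tstar n)%N & (tstar n + v n <= n)%N].
    by near: n; exact: near_cp.
  have : N.+1%:R <= n%:R * ((1 - tau) / 2) :> R.
    rewrite -ler_pdivrMr// (le_trans (ltW kN))// ler_nat.
    by near: n; exact: nbhs_infty_ge.
  move: ts2; move: (n%:R : R) (N.+1%:R : R) ((tstar n)%:R : R) => a b e; lra.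
have [statY1 condY1] := hA1; have [statY2 condY2] := hA2.
have [cv_u [phi [A3 A4]]] := condY1 _ _ seg_u.
have [cv_1 [_ [_ [c2_1 _]]]] := condY1 _ _ seg_1.
have [cv_2 [_ [_ [c2_2 _]]]] := condY2 _ _ seg_2.
have c2 : \forall n \near \oo, forall t w, (1 <= t <= n)%N -> C2_on Theta (c n w t).
  apply: filterS2 c2_1 c2_2 => n H1 H2 t w /andP[t1 tn].
  by have [tts|tst] := leqP t (tstar n); [apply: H1|apply: H2]; apply/andP.
have mY : \forall n \near \oo, forall t i, (1 <= t <= n)%N ->
    measurable_fun setT (fun w => tnth (Y n t w) i).
  apply: filterS hH1 => n [_ HY] t i tn.
  have [[[m1 _] _] [[m2 _] _]] := (statY1, statY2).
  have [tts|tst] := leqP t (tstar n).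
    have := m1 t%:Z i; apply: eq_measurable_fun => w _.
    by rewrite (HY t w tn) tts.
  have := m2 t%:Z i; apply: eq_measurable_fun => w _.
  by rewrite (HY t w tn) leqNgt tst.
have mc : \forall n \near \oo, forall t x, (1 <= t <= n)%N ->
    measurable_fun setT (fun w => c n w t x).
  apply: filterS mY => n HY t x /andP[t1 tn].
  apply: (measurableT_comp (@hphihat t x)); apply: measurable_history => s i /andP[s1 st].
  by apply: HY; rewrite s1 (leq_trans st).
have [_ [_ [phi_C1 [statg [cvgZ [_ [[statX [ergX [sqX mdX]]] pdG]]]]]]] := A3.
have [_ [phi_C2 [[statH _] [iH [cvgH [Funit _]]]]]] := A4.
have c_th : \forall n \near \oo, forall w,
    Theta (thetahat n 1 (u n) w) /\ Theta (thetahat n (u n).+1 n w).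
  near=> n => w.
  have un : (u n <= tstar n)%N by near: n.
  have u1 : (1 < u n)%N by near: n.
  have /andP[_ tn] : (1 < tstar n < n)%N by near: n.
  have unn : (u n < n)%N by exact: leq_ltn_trans un tn.
  by split; [case: (@hthetahat n 1%N (u n) w)|case: (@hthetahat n (u n).+1 n w)];
    rewrite // ?(ltnW u1) ?(ltnW unn) ?unn.
have mZ : \forall n \near \oo, measurable_fun setT (fun w =>
    (Num.sqrt (u n - 1)%N%:R)^-1%:E * \sum_(1 <= t < (u n).+1)
      supnorm Theta (fun y => (gradient (c n w t) y - gradient (phi t%:Z w) y)%R))%E.
  near=> n; apply: measurable_funeM.
  have unn : (u n <= n)%N.
    have un : (u n <= tstar n)%N by near: n.
    have /andP[_ tn] : (1 < tstar n < n)%N by near: n.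
    exact: leq_trans un (ltnW tn).
  have c2n : forall t w, (1 <= t <= n)%N -> C2_on Theta (c n w t) by near: n.
  have mcn : forall t x, (1 <= t <= n)%N -> measurable_fun setT (fun w => c n w t x).
    by near: n.
  pose h t w := if (1 <= t < (u n).+1)%N then supnorm Theta (fun y =>
    (gradient (c n w t) y - gradient (phi t%:Z w) y)%R) else 0%E.
  have -> : (fun w => \sum_(1 <= t < (u n).+1) supnorm Theta (fun y =>
      (gradient (c n w t) y - gradient (phi t%:Z w) y)%R))%E =
      (fun w => \sum_(1 <= t < (u n).+1) h t w)%E.
    by apply/funext => w; apply: eq_big_nat => t tu; rewrite /h tu.
  apply: emeasurable_sum => t; rewrite /h.
  case tu : (1 <= t < (u n).+1)%N; last exact: measurable_cst.
  have tn : (1 <= t <= n)%N.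
    by move: tu => /andP[-> tu]; rewrite (leq_trans _ unn).
  apply: (@measurable_supnorm _ _ _ _ _ _ Theta (fun w y =>
    gradient (c n w t) y - gradient (phi t%:Z w) y) Theta0) => [x i j Tx|w x Tx]; last first.
    have [c1 _] := c2n t w tn.
    have cvgc := gradient_continuous c1 Tx.
    have cvgp := gradient_continuous (phi_C1 t%:Z w) Tx.
    exact: cvgB cvgc cvgp.
  apply: measurable_mxB => {i j} i j.
    under eq_fun do rewrite mxE.
    apply: (@measurable_partial_at _ _ _ _ (fun=> x)) => [k|y|w].
    - exact: measurable_cst.
    - exact: mcn.
    - by have [c1 _] := c2n t w tn; apply: C1_on_sub c1 => _ ->.
  by rewrite ord1; have [[mg _] _] := statg _ Tx; exact: mg.
have eq_lee (a b : \bar R) : a = b -> (a <= b)%E by move=> ->.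
move=> M; apply: cvg_probability1.
  near=> n; rewrite -[X in measurable X]setTI.
  apply: emeasurable_fun_o_infty => //.
  have c2n : forall t w, (1 <= t <= n)%N -> C2_on Theta (c n w t) by near: n.
  have mcn : forall t x, (1 <= t <= n)%N -> measurable_fun setT (fun w => c n w t x).
    by near: n.
  have Tn : forall w, Theta (thetahat n 1 (u n) w) /\ Theta (thetahat n (u n).+1 n w).
    by near: n.
  have un : (u n <= tstar n)%N by near: n.
  have /andP[_ tn] : (1 < tstar n < n)%N by near: n.
  apply: (@measurable_Qhat _ _ _ _ Theta (c n) (fun l l' w => thetahat n l l' w)) => //.
  - exact: leq_trans un (ltnW tn).
  - by move=> w; case: (Tn w).
  - by move=> w; case: (Tn w).
move=> e e0.
pose N (t : nat) w := supnorm Theta (hessian (phi t%:Z w)).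
pose V (t : nat) w := (mxnorm1 (gradient (phi t%:Z w) theta1))%:E.
have N0 t w : (0 <= N t w)%E by exact: supnorm_ge0.
have V0 t w : (0 <= V t w)%E by rewrite lee_fin mxnorm1_ge0.
have mN t : measurable_fun setT (N t).
  apply: (@measurable_supnorm _ _ _ _ _ _ Theta (fun w => hessian (phi t%:Z w)) Theta0)
    => [x i j Tx|w x Tx].
    exact: measurable_hessian_phi statH Tx.
  by apply: hessian_continuous Tx => i; exact: phi_C2.
have mX t i : measurable_fun setT (fun w => gradient (phi t w) theta1 i 0).
  by have [mX _] := statX; exact: mX.
have mV t : measurable_fun setT (V t).
  apply/measurable_EFinP; apply: measurable_mxnorm1 => i j; rewrite ord1.
  exact: mX.
have [m1 m10 Nm] : exists2 m1 : R, 0 <= m1 & forall t, (\int[P]_w N t w <= m1%:E)%E.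
  have fi : (\int[P]_w N 0%N w)%E \is a fin_num.
    by rewrite ge0_fin_numE ?iH// integral_ge0.
  exists (fine (\int[P]_w N 0%N w)%E); first by rewrite fine_ge0 ?integral_ge0.
  move=> t; rewrite (fineK fi).
  by apply: eq_lee; exact: stationary_supnorm_hessian Theta0 statH phi_C2.
have [m2 m20 Vm] : exists2 m2 : R, 0 <= m2 & forall t, (\int[P]_w V t w <= m2%:E)%E.
  have iV : P.-integrable setT (V 0%N).
    have iX i : P.-integrable setT (EFin \o (fun w => `|gradient (phi 0 w) theta1 i 0|)).
      by have [_ iX _] := mdX 0 i; exact: integrable_norm iX.
    have := integrable_sum_EFin (index_enum _) iX.
    by apply: eq_integrable => // w _; rewrite /V mxnorm1_col.
  exists (fine (\int[P]_w V 0%N w)%E); first by rewrite fine_ge0 ?integral_ge0.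
  have fi : (\int[P]_w V 0%N w)%E \is a fin_num by exact: integrable_fin_num.
  move=> t; rewrite (fineK fi).
  by apply: eq_lee; exact: stationary_mxnorm1_gradient t statX.
pose L := 3 * (m1 + m2 + 1) / e.
have m0 : 0 < m1 + m2 + 1 by rewrite ltr_wpDl// addr_ge0.
have L0 : 0 < L by rewrite divr_gt0// mulr_gt0.
have mL a : a <= m1 + m2 + 1 -> a / L <= e / 3.
  move=> am; rewrite ler_pdivrMr//.
  by have -> : e / 3 * L = m1 + m2 + 1 by rewrite /L; field; rewrite gt_eqF.
pose EN n := [set w | (\sum_(1 <= t < (u n).+1) N t w <= ((u n)%:R * L)%:E)%E].
pose EV n := [set w | (\sum_(1 <= t < (u n).+1) V t w <= ((u n)%:R * L)%:E)%E].
pose Z n w := ((Num.sqrt (u n - 1)%N%:R)^-1%:E * \sum_(1 <= t < (u n).+1)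
      supnorm Theta (fun y => (gradient (c n w t) y - gradient (phi t%:Z w) y)%R))%E.
pose EZ n := [set w | (Z n w <= 1%:E)%E].
exists (fun n => EN n `&` EV n `&` EZ n); split.
  have PZ : \forall n \near \oo, (P (~` EZ n) <= (e / 3)%:E)%E.
    have e3 : (0%:E < (e / 3)%:E :> \bar R)%E by rewrite lte_fin divr_gt0.
    have near_e3 : \forall n \near \oo, (P [set w | 1%:E < Z n w] < (e / 3)%:E)%E.
      exact: cvgZ 1 ltr01 _ (open_ereal_lt' e3).
    apply: filterS near_e3 => n /ltW; apply: le_trans; rewrite le_eqVlt; apply/orP; left; apply/eqP; congr (P _).
    apply/seteqP; split => w; rewrite /EZ /=; first by move=> /negP; rewrite -ltNge.
    by move=> Zw; apply/negP; rewrite -ltNge.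
  near=> n.
  have mle (f : T -> \bar R) y : measurable_fun setT f -> measurable [set w | (f w <= y)%E].
    by move=> mf; rewrite -[X in measurable X]setTI; apply: emeasurable_fun_infty_c.
  have mEN : measurable (EN n) by apply: mle; exact: emeasurable_sum.
  have mEV : measurable (EV n) by apply: mle; exact: emeasurable_sum.
  have mEZ : measurable (EZ n) by apply: mle; near: n.
  have u0 : (0 < u n)%N by apply: ltnW; near: n.
  split; first by apply: measurableI => //; exact: measurableI.
  rewrite !setCI.
  have -> : e = e / 3 + e / 3 + e / 3 by lra.
  rewrite 2!EFinD.
  apply: le_trans (measureU2 _ _ _) _; [| exact: measurableC|].
    by apply: measurableU; exact: measurableC.
  apply: leeD; last by near: n.
  apply: le_trans (measureU2 _ _ _) _; [exact: measurableC|exact: measurableC|].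
  apply: leeD.
    apply: le_trans (markov_sum L0 mN N0 Nm u0) _.
    by rewrite lee_fin mL//; lra.
  apply: le_trans (markov_sum L0 mV V0 Vm u0) _.
  by rewrite lee_fin mL//; lra.
have aeG : {ae P, forall w, forall i j,
    (\sum_(1 <= t < n.+1) direction_mx (gradient (phi t%:Z w) theta1) i j) / n%:R
    @[n --> \oo] --> expect_mx P (fun w => direction_mx (gradient (phi 0 w) theta1)) i j}.
  apply: filter_forall => i; apply: filter_forall => j.
  exact: ergodic_direction_mx.
have detG : \det (expect_mx P (fun w => direction_mx (gradient (phi 0 w) theta1))) != 0.
  by apply: expect_direction_mx_det => // i; exact: sqX.
have aeT : {ae P, forall w, [/\ thetahat n 1 (tstar n) w @[n --> \oo] --> theta1,
    thetahat n (tstar n).+1 n w @[n --> \oo] --> theta2 &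
    supnorm Theta (fun x => (u n - 1)%N%:R^-1 *:
       (\sum_(1 <= t < (u n).+1) hessian (c n w t) x) - Fmx P phi x) @[n --> \oo] --> 0%E]}.
  by apply: filterS3 cv_1 cv_2 cvgH => w; split.
apply: filterS3 aeG cv_u aeT => w Gw thu [th1 th2 Hw].
have Fw : Fmx P phi (thetahat n 1 (u n) w) @[n --> \oo] --> Fmx P phi theta1.
  apply: (@Fmx_cvg _ _ _ _ _ Theta) => //.
    by move=> x i j Tx; exact: measurable_hessian_phi statH Tx.
  by apply: filterS c_th => n /(_ w)[].
have c2w : \forall n \near \oo, forall t, (1 <= t <= n)%N -> C2_on Theta (c n w t).
  by apply: filterS c2 => n H t tn; exact: H.
have thw : \forall n \near \oo,
    Theta (thetahat n 1 (u n) w) /\ Theta (thetahat n (u n).+1 n w).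
  by apply: filterS c_th => n /(_ w).
have thw1 : \forall n \near \oo, Theta (thetahat n 1%N (u n) w).
  by apply: filterS thw => n [].
have Fhw := @Fhat_cvg R d Theta (fun n => c n w) (fun n l l' => thetahat n l l' w) u
  (Fmx P phi) theta1 hu thw1 Hw Fw.
have := @Qhat_eventually_gt R d Theta (fun n => c n w) (fun t => phi t%:Z w)
  (fun n l l' => thetahat n l l' w) theta1 theta2 u v tstar tau (Fmx P phi theta1)
  (expect_mx P (fun w => direction_mx (gradient (phi 0 w) theta1))) tau01 tsE hu hun hvn
  c2w thw thu th1 th2 hint1 htheta (fun t i => phi_C2 t%:Z w i) Fhw Funit Gw detG L M L0.
apply: filterS => n Hn [[HN HV] HZ].
by apply: Hn; split; [exact: HN|exact: HV|exact: HZ].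
Unshelve. all: by end_near. Qed.
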